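(* Consider a PACS-structure of Kähler type on a smooth manifold $M$ corresponding to a conformal class of almost Hermitian metrics $(g,J)$ on $M$. Then the harmonic torsion $T_h$ of the geometry coincides (up to a non-zero constant factor) with the Nijenhuis tensor of the almost complex structure $J$. In particular, the canonical connection $\nabla$ of the structure is torsion free if and only if the structure is a PCS-structure and $J$ is an integrable complex structure. This is equivalent to the conformal class locally containing (pseudo-)Kähler metrics of the given signature, which then are unique up to a constant factor. In this case, the canonical connection coincides with the Levi-Civita connections of the local Kähler metrics in the conformal class.
   Context: An almost conformally symplectic structure on a smooth manifold $M$ of even dimension $\geq 4$ is a smooth line subbundle $\ell\subset\Lambda^2T^*M$ all of whose non-zero elements are non-degenerate; it is conformally symplectic if locally around each $x\in M$ there is a smooth section of $\ell$ which is closed as a two-form and non-zero at $x$. A PACS-structure (parabolic almost conformally symplectic structure) of Kähler type of signature $(p,q)$ on a manifold $M$ of real dimension $2(p+q)\geq 4$ is a reduction of the structure group of the linear frame bundle of $M$ to the group $G_0\cong CU(p,q)$ of those complex linear automorphisms of $\mathbb C^{p+q}$ which preserve, up to a real factor, the imaginary part of a Hermitian form of signature $(p,q)$. (This comes from the contact grading of $\mathfrak{su}(p+1,q+1)$.) Equivalently, it is a conformal class of almost Hermitian metrics $(g,J)$ of this signature on $M$, i.e. an almost complex structure $J$ and a conformal class of pseudo-Riemannian metrics $g$ such that $g(J\xi,J\eta)=g(\xi,\eta)$. The underlying almost conformally symplectic structure $\ell\subset\Lambda^2T^*M$ is spanned by the fundamental two-forms $\omega(\xi,\eta)=-g(\xi,J\eta)$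 of the metrics in the class. The structure is called a PCS-structure if $\ell$ is conformally symplectic. An almost Hermitian metric is (pseudo-)Kähler if its fundamental two-form is closed and $J$ is integrable. Let $\mathcal H\subset\Lambda^2T^*M\otimes TM$ be the subbundle of skew symmetric bilinear maps which are of type $(0,2)$, i.e. conjugate linear with respect to $J$ in both arguments. (This is the subbundle of algebraically harmonic elements, induced by the kernel of the Kostant Laplacian in homogeneity one for the contact grading.) Non-degeneracy of $\ell$ gives $TM\cong T^*M\otimes\ell^*$, and hence an inclusion $\Lambda^3_0T^*M\otimes\ell^*\subset\Lambda^2T^*M\otimes T^*M\otimes\ell^*\cong\Lambda^2T^*M\otimes TM$, where $\Lambda^3_0T^*M$ denotes the tracefree part of $\Lambda^3T^*M$, the kernel of contraction with the inverses of non-zero elements of $\ell$. There is a unique linear connection $\nabla$ on $TM$ which is compatible with the PACS-structure (i.e. preserves $J$ and $\ell$) and whose torsion $T$ is a section of $\mathcal H\oplus(\Lambda^3_0T^*M\otimes\ell^* )$. This is the canonical connection; decomposing $T=T_h\oplus T_a$ accordingly, the component $T_h$ in $\mathcal H$ is called the harmonic torsion.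
   Formalization: T_h is taken as the full (0,2)-part of T, since H meets the tracefree 3-forms if p+q>=3 and T=T_h+T_a is not unique; ''torsion free iff PCS and J integrable'' is claimed for p+q>=3 only; in dimension 4, where it fails, PCS is assumed and then torsion free iff J integrable. *)

(* Defs.v *)
(* MathComp / MathComp-Analysis *)
From HB Require Import structures.
From mathcomp Require Import all_boot all_order all_algebra.
From mathcomp Require Import all_classical all_reals all_analysis.
Set Implicit Arguments.
Unset Strict Implicit.
Unset Printing Implicit Defensive.
Import Order.TTheory GRing.Theory Num.Theory.
Import numFieldNormedType.Exports.
Local Open Scope classical_set_scope.
Local Open Scope ring_scope.

(* Conventions. Tangent vectors are row vectors v; an endomorphism with matrix
   A acts by v |-> v *m A; a bilinear form with matrix G is
   (v, w) |-> v *m G *m w^T. Tensor fields and connections are given by their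
   components in all charts of an atlas, subject to the transformation rules;
   only the values on the images of the charts are meaningful. *)

Section Calculus.
Variables (R : realType) (m : nat).
Implicit Types (U : set 'rV[R]_m) (u : 'rV[R]_m) (a b c : 'I_m).

Definition pd a (f : 'rV[R]_m -> R) u : R := 'D_(delta_mx 0 a) f u.

Fixpoint Ck (k : nat) U (f : 'rV[R]_m -> R) : Prop :=
  (forall u, U u -> {for u, continuous f}) /\
  (if k is k'.+1 then
     forall a, (forall u, U u -> derivable f u (delta_mx 0 a)) /\
               Ck k' U (pd a f)
   else True).

(* meaningful for open U *)
Definition smooth U (f : 'rV[R]_m -> R) : Prop := forall k, Ck k U f.

Definition dmx a (F : 'rV[R]_m -> 'M[R]_m) u : 'M[R]_m :=
  \matrix_(b, c) pd a (fun u' => F u' b c) u.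

Definition smooth_vf U (X : 'rV[R]_m -> 'rV[R]_m) : Prop :=
  forall a, smooth U (fun u => X u 0 a).

Definition lie (X Y : 'rV[R]_m -> 'rV[R]_m) u : 'rV[R]_m :=
  \row_b \sum_a (X u 0 a * pd a (fun u' => Y u' 0 b) u
                 - Y u 0 a * pd a (fun u' => X u' 0 b) u).

Definition app (J : 'rV[R]_m -> 'M[R]_m) (X : 'rV[R]_m -> 'rV[R]_m) u :=
  X u *m J u.

Definition nijenhuis (J : 'rV[R]_m -> 'M[R]_m) (X Y : 'rV[R]_m -> 'rV[R]_m) u
    : 'rV[R]_m :=
  lie X Y u - lie (app J X) (app J Y) u
  + lie (app J X) Y u *m J u + lie X (app J Y) u *m J u.

(* A complex vector field X + iY is the pair (X, Y) of real vector fields;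
   it is of type (0,1) if J (X + iY) = - i (X + iY). *)
Definition type01 (J : 'rV[R]_m -> 'M[R]_m) U
    (Z : ('rV[R]_m -> 'rV[R]_m) * ('rV[R]_m -> 'rV[R]_m)) : Prop :=
  forall u, U u -> app J Z.1 u = Z.2 u /\ app J Z.2 u = - Z.1 u.

Definition clie (Z W : ('rV[R]_m -> 'rV[R]_m) * ('rV[R]_m -> 'rV[R]_m)) :=
  ((fun u => lie Z.1 W.1 u - lie Z.2 W.2 u),
   (fun u => lie Z.1 W.2 u + lie Z.2 W.1 u)).

End Calculus.

Record manifold (R : realType) (m : nat) := Manifold {
  mcarrier :> topologicalType;
  mhausdorff : hausdorff_space mcarrier;
  msecond_countable : @second_countable mcarrier;
  mindex : Type;
  mdom : mindex -> set mcarrier;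
  mchart : mindex -> mcarrier -> 'rV[R]_m;
  mpar : mindex -> 'rV[R]_m -> mcarrier;
  mdom_open : forall i, open (mdom i);
  mdom_cover : forall x, exists i, mdom i x;
  mcod_open : forall i, open (mchart i @` mdom i);
  mchartK : forall i x, mdom i x -> mpar i (mchart i x) = x;
  mchart_continuous : forall i x, mdom i x -> {for x, continuous (mchart i)};
  mpar_continuous : forall i u, (mchart i @` mdom i) u ->
    {for u, continuous (mpar i)};
  mtransition_smooth : forall i j,
    smooth_vf (mchart i @` (mdom i `&` mdom j)) (mchart j \o mpar i)
}.

Section Fields.
Variables (R : realType) (m : nat) (M : manifold R m).
Implicit Types (V : set M) (i j : mindex M) (x : M) (u : 'rV[R]_m)
               (a b c : 'I_m).

Definition mxfield := mindex M -> 'rV[R]_m -> 'M[R]_m.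

(* Components T(e_a, e_b) = \sum_c (T i u a) b c e_c of a section of
   T*M (x) T*M (x) TM; the same type holds Christoffel symbols,
   nabla_{e_a} e_b = \sum_c (Gamma i u a) b c e_c. *)
Definition field12 := mindex M -> 'rV[R]_m -> 'I_m -> 'M[R]_m.

Definition cod V i : set 'rV[R]_m := mchart i @` (mdom i `&` V).

Definition jac i j u : 'M[R]_m :=
  \matrix_(a, b) pd a (fun u' => mchart j (mpar i u') 0 b) u.

Definition smooth_mxfield V (F : mxfield) : Prop :=
  forall i a b, smooth (cod V i) (fun u => F i u a b).

Definition endo_field V (F : mxfield) : Prop :=
  smooth_mxfield V F /\
  forall i j x, V x -> mdom i x -> mdom j x ->
    F i (mchart i x) *m jac i j (mchart i x)
    = jac i j (mchart i x) *m F j (mchart j x).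

Definition bilin_field V (F : mxfield) : Prop :=
  smooth_mxfield V F /\
  forall i j x, V x -> mdom i x -> mdom j x ->
    F i (mchart i x)
    = jac i j (mchart i x) *m F j (mchart j x) *m (jac i j (mchart i x))^T.

Definition closed_form V (W : mxfield) : Prop :=
  forall i u, cod V i u -> forall a b c,
    pd a (fun u' => W i u' b c) u + pd b (fun u' => W i u' c a) u
    + pd c (fun u' => W i u' a b) u = 0.

Definition almost_complex V (J : mxfield) : Prop :=
  endo_field V J /\ forall i u, cod V i u -> J i u *m J i u = - 1%:M.

(* involutivity of the distribution of (0,1)-vectors *)
Definition integrable_acs V (J : mxfield) : Prop :=
  forall i (U : set 'rV[R]_m), open U -> U `<=` cod V i ->
  forall Z W, smooth_vf U Z.1 -> smooth_vf U Z.2 ->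
    smooth_vf U W.1 -> smooth_vf U W.2 ->
    type01 (J i) U Z -> type01 (J i) U W -> type01 (J i) U (clie Z W).

(* N is tensorial, hence determined by the coordinate vector fields. *)
Definition nijenhuis_tensor (J : mxfield) : field12 := fun i u a =>
  \matrix_(b, c)
    nijenhuis (J i) (cst (delta_mx 0 a)) (cst (delta_mx 0 b)) u 0 c.

(* The inhomogeneous term is the Hessian of the coordinate change. *)
Definition is_connection V (Gam : field12) : Prop :=
  (forall i a b c, smooth (cod V i) (fun u => Gam i u a b c)) /\
  forall i j x, V x -> mdom i x -> mdom j x -> forall a,
    let u := mchart i x in
    Gam i u a *m jac i j u
    = dmx a (jac i j) u
      + jac i j u *m \sum_b jac i j u a b *: Gam j (mchart j x) b.

Definition cov_endo (Gam : field12) (F : mxfield) i u a : 'M[R]_m :=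
  dmx a (F i) u + F i u *m Gam i u a - Gam i u a *m F i u.

Definition cov_bilin (Gam : field12) (F : mxfield) i u a : 'M[R]_m :=
  dmx a (F i) u - Gam i u a *m F i u - F i u *m (Gam i u a)^T.

Definition torsion (Gam : field12) : field12 := fun i u a =>
  \matrix_(b, c) (Gam i u a b c - Gam i u b a c).

Definition torsion_free V (Gam : field12) : Prop :=
  forall i u, cod V i u -> forall a, torsion Gam i u a = 0.

Definition levi_civita V (g : mxfield) (Gam : field12) : Prop :=
  [/\ is_connection V Gam, torsion_free V Gam
    & forall i u, cod V i u -> forall a, cov_bilin Gam g i u a = 0].

End Fields.

Section Pointwise.
Variables (R : realType) (m : nat).
Implicit Types (J G W : 'M[R]_m) (T : 'I_m -> 'M[R]_m) (v w : 'rV[R]_m).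

(* real signature (r, m - r) *)
Definition has_signature (r : nat) G : Prop :=
  exists2 P : 'M[R]_m, P \in unitmx &
    P *m G *m P^T = diag_mx (\row_k (if (k < r)%N then 1 else -1)).

(* omega(v, w) = - g(v, J w) *)
Definition fundamental J G : 'M[R]_m := - (G *m J^T).

Definition eval12 T v w : 'rV[R]_m := \sum_a v 0 a *: (w *m T a).

Definition type02 J T : Prop :=
  forall v w,
    [/\ eval12 T v w = - eval12 T w v,
        eval12 T (v *m J) w = - (eval12 T v w *m J)
      & eval12 T v (w *m J) = - (eval12 T v w *m J)].

(* four times the (0,2)-component of T *)
Definition proj02 J T v w : 'rV[R]_m :=
  eval12 T v w - eval12 T (v *m J) (w *m J)
  + eval12 T (v *m J) w *m J + eval12 T v (w *m J) *m J.

(* T, made into a trilinear form tau(a,b,c) = W(T(e_a,e_b),e_c) by the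
   non-degenerate two-form W, is alternating and tracefree. *)
Definition lambda30 W T : Prop :=
  let tau a b c := (T a *m W) b c in
  [/\ forall a b c, tau a b c = - tau b a c,
      forall a b c, tau a b c = - tau a c b
    & forall c, \sum_a \sum_b invmx W a b * tau a b c = 0].

End Pointwise.

Definition almost_hermitian (R : realType) (p q : nat)
    (M : manifold R (p + q).*2) (V : set M) (J g : mxfield M) : Prop :=
  bilin_field V g /\
  forall i u, cod V i u ->
    [/\ (g i u)^T = g i u,
        J i u *m g i u *m (J i u)^T = g i u
      & has_signature p.*2 (g i u)].

(* conf is the set of non-zero elements of a line subbundle of S^2 T*M which is
   locally spanned by almost Hermitian metrics of signature (p, q). Real
   (rather than positive) factors are those allowed by CU(p,q). For p <> q the
   local metrics of signature (p, q) in conf form a conformal class in the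
   strict sense; for p = q this also covers structures for which the sign
   cannot be chosen globally. *)
Record pacs (R : realType) (p q : nat) (M : manifold R (p + q).*2) := Pacs {
  cstr : mxfield M;
  conf : mindex M -> 'rV[R]_((p + q).*2) -> set 'M[R]_((p + q).*2);
  cstr_almost_complex : almost_complex setT cstr;
  conf_local : forall x : M, exists V : set M, exists g : mxfield M,
    [/\ open V, V x, almost_hermitian V cstr g
      & forall i u, cod V i u ->
          conf i u = [set G | exists2 c : R, c != 0 & G = c *: g i u]]
}.

Section PACS.
Variables (R : realType) (p q : nat) (M : manifold R (p + q).*2).
Variable S : pacs M.
Implicit Types (V : set M) (g : mxfield M) (nabla Th : field12 M).

Definition in_class V g : Prop :=
  almost_hermitian V (cstr S) g /\
  forall i u, cod V i u -> conf S i u (g i u).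

(* the fibre of the line subbundle of two-forms *)
Definition ell i u : set 'M[R]_((p + q).*2) :=
  [set W | exists c : R, exists2 G, conf S i u G &
     W = c *: fundamental (cstr S i u) G].

Definition section_ell V (W : mxfield M) : Prop :=
  bilin_field V W /\ forall i u, cod V i u -> ell i u (W i u).

Definition pcs : Prop :=
  forall x : M, exists V : set M, exists W : mxfield M,
    [/\ open V, V x, section_ell V W, closed_form V W
      & forall i, mdom i x -> W i (mchart i x) != 0].

Definition kahler V g : Prop :=
  closed_form V (fun i u => fundamental (cstr S i u) (g i u)) /\
  integrable_acs V (cstr S).

Definition kahler_in_class V g : Prop := in_class V g /\ kahler V g.

Definition locally_kahler : Prop :=
  forall x : M, exists V : set M, exists g : mxfield M,
    [/\ open V, V x & kahler_in_class V g].

Definition in_H i u (T : 'I_((p + q).*2) -> 'M[R]_((p + q).*2)) : Prop :=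
  type02 (cstr S i u) T.

Definition in_L i u (T : 'I_((p + q).*2) -> 'M[R]_((p + q).*2)) : Prop :=
  forall W, ell i u W -> W != 0 -> lambda30 W T.

Definition compatible nabla : Prop :=
  (forall i u, cod setT i u -> forall a, cov_endo nabla (cstr S) i u a = 0) /\
  forall V (W : mxfield M), open V -> section_ell V W ->
    forall i u, cod V i u -> forall a, ell i u (cov_bilin nabla W i u a).

Definition canonical_connection nabla : Prop :=
  [/\ is_connection setT nabla, compatible nabla
    & forall i u, cod setT i u ->
        exists Th Ta : 'I_((p + q).*2) -> 'M[R]_((p + q).*2),
        [/\ in_H i u Th, in_L i u Ta
          & forall a, torsion nabla i u a = Th a + Ta a]].

(* If p + q >= 3, the bundles in_H and in_L intersect in the real parts of
   (3,0)-forms (for p + q = 2, in_L is zero), so their sum is not direct.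
   The decomposition is made unique by letting T_h be the full component of
   type (0,2), i.e. T_a has no such component. *)
Definition harmonic_torsion nabla Th : Prop :=
  forall i u, cod setT i u ->
    let Ta := fun a => torsion nabla i u a - Th i u a in
    [/\ in_H i u (Th i u), in_L i u Ta
      & forall v w, proj02 (cstr S i u) Ta v w = 0].

End PACS.

(* Main.v *)
(* A connection preserving J has a torsion whose (0,2)-part is -1/4 of the
   Nijenhuis tensor N.  The projection to type (0,2) preserves alternating
   tracefree trilinear forms, so removing the (0,2)-part from the torsion of
   the canonical connection leaves a section of the second summand; this gives
   T_h = -N/4.

   If W spans ell locally, then nabla W = theta W, and antisymmetrization gives
   dW = theta /\ W + 3 tau, where tau is the alternating part of the torsion,
   lowered with W.  If W is closed and N = 0, then the torsion is alternating
   and tracefree, and contracting with the inverse of W gives theta = 0, hence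
   tau = 0: the torsion vanishes, W and g are parallel, and nabla is the
   Levi-Civita connection.  Conversely, if the torsion vanishes, then
   dW = theta /\ W, so d theta /\ W = 0 and, in dimension at least 6,
   d theta = 0; writing theta = df, the form exp(-f) W is closed.  Two Kaehler
   metrics differ by a function f with df /\ W = 0, hence df = 0. *)

(* The dimension enters through two contractions with the inverse of [W]. From [theta /\ W] one
   recovers [(2 - m) theta], so wedging one-forms with [W] is injective in every dimension allowed
   here. From [F /\ W], with [F] a two-form, one recovers [(4 - m) F] plus a multiple of [W]. In
   dimension four this breaks down: the products [theta /\ W] already fill all three-forms, so
   [dW = theta /\ W] constrains nothing, and [dtheta /\ W = 0] is a single scalar equation. Locality
   shapes the rest. The form [theta] arises pointwise, and its primitive lives on a ball in one
   chart, while closedness and integrability are required in all charts. Hence closedness is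
   transported between charts, integrability passes through the pointwise (0,2)-part of the torsion,
   and ratios of metrics are treated as functions on [M]. Moreover, a closed section of [ell]
   determines a metric only up to sign: [ell] does not distinguish signature (p, q) from (q, p). *)
Require Import Defs.
From HB Require Import structures.
From mathcomp Require Import all_boot all_order all_algebra.
From mathcomp Require Import all_classical all_reals all_analysis.
From mathcomp Require Import ring lra.
Import Order.TTheory GRing.Theory Num.Theory.
Import numFieldNormedType.Exports.
Local Open Scope classical_set_scope.
Local Open Scope ring_scope.
Set Implicit Arguments.
Unset Strict Implicit.
Unset Printing Implicit Defensive.

(** * Differentiable functions of several variables *)

Section LineDerivative.
Variables (R : realType) (V : normedModType R).
Implicit Types (f : V -> R) (u v : V) (s t : R).

Lemma is_derive_line f u v s :
  derivable f (u + s *: v) v ->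
  is_derive s 1 (fun s' => f (u + s' *: v)) ('D_v f (u + s *: v)).
Proof.
have E : (fun h : R => h^-1 *: (((fun s' => f (u + s' *: v)) \o shift s) (h *: 1)
            - f (u + s *: v))) =
         (fun h => h^-1 *: ((f \o shift (u + s *: v)) (h *: v) - f (u + s *: v))).
  apply/funext => h /=; congr (_ *: (f _ - _)).
  by rewrite [h *: 1]mulr1 scalerDl addrCA addrA.
move=> df; split; first by rewrite /derivable E.
by rewrite /derive E.
Qed.

(** Coordinate increments have either sign, hence the symmetric bound on [s] and two uses of the
    one-variable mean value theorem. *)
Lemma line_mvt f u v t :
  (forall s, `|s| <= `|t| -> derivable f (u + s *: v) v) ->
  exists2 s, `|s| <= `|t| & f (u + t *: v) - f u = t * 'D_v f (u + s *: v).
Proof.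
move=> df; pose g s := f (u + s *: v).
have dg s : `|s| <= `|t| -> is_derive s 1 g ('D_v f (u + s *: v)).
  by move=> /df; exact: is_derive_line.
have cg a b : (forall s, s \in `[a, b] -> `|s| <= `|t|) ->
    {within `[a, b], continuous g}.
  move=> ab; apply: derivable_within_continuous => s /ab /dg sd.
  exact: (@ex_derive _ _ _ _ _ _ _ sd).
have [t0|t0] := leP 0 t.
  have le s : s \in `[0, t] -> `|s| <= `|t|.
    by rewrite in_itv /= => /andP[s0 st]; rewrite !ger0_norm.
  have [|s st] := @MVT_segment _ g (fun s => 'D_v f (u + s *: v)) 0 t t0 _ (cg _ _ le).
    by move=> s st; apply/dg/le/subset_itv_oo_cc.
  rewrite subr0 /g scale0r addr0 mulrC => E; exists s => //; exact: le.
have le s : s \in `[t, 0] -> `|s| <= `|t|.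
  by rewrite in_itv /= => /andP[s0 st]; rewrite !ler0_norm ?lerN2 // ltW.
have [|s st] := @MVT_segment _ g (fun s => 'D_v f (u + s *: v)) t 0 (ltW t0) _ (cg _ _ le).
  by move=> s st; apply/dg/le/subset_itv_oo_cc.
rewrite sub0r /g scale0r addr0 => E; exists s; first exact: le.
by rewrite -opprB E mulrN opprK mulrC.
Qed.

Lemma diff_eps f (L : {linear V -> R}) u : continuous L ->
  (forall e, 0 < e -> \forall h \near 0, `|f (h + u) - f u - L h| <= e * `|h|) ->
  differentiable f u /\ ('d f u : V -> R) = L.
Proof.
move=> cL H.
have E : f \o shift u = cst (f u) + L +o_ 0 id.
  apply/eqaddoP => e e0; have := H e e0; apply: filterS => h /=.
  by rewrite opprD addrA.
have D := diff_unique cL E; split=> //.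
by apply/diff_locallyP; rewrite D.
Qed.

End LineDerivative.

Lemma continuous_sumr (R : realType) (T : topologicalType) n (F : 'I_n -> T -> R) x :
  (forall a, {for x, continuous (F a)}) ->
  {for x, continuous (fun y => \sum_a F a y)}.
Proof.
move=> cF; apply: (@cvg_big _ _ _ _ xpredT (@add_continuous R)) => a _.
exact: cF.
Qed.

(** * Continuous partial derivatives and differentiability *)

Section C1.
Variables (R : realType) (m : nat).
Implicit Types (U : set 'rV[R]_m) (f g : 'rV[R]_m -> R) (u : 'rV[R]_m).
Local Notation e_ a := (delta_mx 0 a : 'rV[R]_m).

Lemma row_entry_le (h : 'rV[R]_m) k : `|h 0 k| <= `|h|.
Proof.
rewrite -[leRHS]/(mx_norm h) mx_normrE; apply/bigmax_geP; right => /=.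
by exists (0, k).
Qed.

Lemma row_norm_le (h : 'rV[R]_m) e : 0 <= e -> (forall k, `|h 0 k| <= e) -> `|h| <= e.
Proof.
move=> e0 H; rewrite -[leLHS]/(mx_norm h) mx_normrE; apply/bigmax_leP; split => //.
by case=> i j _ /=; rewrite ord1.
Qed.

Let trunc (h : 'rV[R]_m) (k : nat) : 'rV[R]_m := \row_b (if (b < k)%N then h 0 b else 0).

Let grad f u (h : 'rV[R]_m) : R := \sum_a h 0 a * pd a f u.

Let grad_linear f u : linear (grad f u).
Proof.
move=> k x y; rewrite /grad scaler_sumr -big_split /=; apply: eq_bigr => a _.
by rewrite !mxE mulrDl -scalerAl.
Qed.

Let gradL f u : {linear 'rV[R]_m -> R} :=
  HB.pack (grad f u) (GRing.isLinear.Build _ _ _ _ _ (@grad_linear f u)).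

Lemma coord_continuous (a : 'I_m) : continuous (fun u : 'rV[R]_m => u 0 a).
Proof. by move=> u; exact/differentiable_continuous/differentiable_coord. Qed.

Lemma C1_diff U f u : open U -> U u ->
  (forall a x, U x -> derivable f x (e_ a)) ->
  (forall a x, U x -> {for x, continuous (pd a f)}) ->
  differentiable f u /\ forall h, 'd f u h = \sum_a h 0 a * pd a f u.
Proof.
move=> Uo Uu fD fC.
suff [] : differentiable f u /\ ('d f u : _ -> _) = gradL f u.
  by move=> ? E; split=> // h; rewrite E.
apply: diff_eps.
  move=> h; apply: continuous_sumr => a.
  by apply: continuousM; [exact: coord_continuous|exact: cst_continuous].
move=> e e0.
(* The error is a sum of [m] terms; dividing by [m + 1] instead of [m] also covers [m = 0]. *)
pose e' := e / m.+1%:R.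
have e'0 : 0 < e' by rewrite divr_gt0 // ltr0n.
have near1 : \forall x \near u, U x /\ forall a, `|pd a f u - pd a f x| <= e'.
  apply: filterI; first exact: open_nbhs_nbhs.
  suff H a : \forall x \near u, `|pd a f u - pd a f x| <= e'.
    exact: (filter_forall _ H).
  by have /cvgrPdist_le/(_ _ e'0) := fC a u Uu.
have [d /= d0 Hd] := (nbhs_ballP _ _).1 near1.
apply/nbhs_ballP; exists d => //= h; rewrite -ball_normE /= sub0r normrN => hd.
(* The coordinates are changed one at a time, with the mean value theorem. *)
have step (k : 'I_m) : `|f (u + trunc h k.+1) - f (u + trunc h k) - h 0 k * pd k f u|
    <= `|h| * e'.
  have tr s : `|s| <= `|h 0 k| -> `|trunc h k + s *: e_ k| <= `|h|.
    move=> sh; apply: row_norm_le => // b; rewrite !mxE eqxx /=.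
    case: ltnP => bk; last rewrite add0r.
      by rewrite -val_eqE /= (ltn_eqF bk) mulr0 addr0 row_entry_le.
    case: eqP => [_|_]; last by rewrite mulr0 normr0.
    by rewrite mulr1 (le_trans sh) ?row_entry_le.
  have trU s : `|s| <= `|h 0 k| ->
      let x := u + trunc h k + s *: e_ k in U x /\ forall a, `|pd a f u - pd a f x| <= e'.
    move=> sh; apply: Hd; rewrite -ball_normE /= -addrA opprD addNKr normrN.
    exact: le_lt_trans (tr _ sh) hd.
  have -> : trunc h k.+1 = trunc h k + h 0 k *: e_ k.
    apply/rowP => b; rewrite !mxE eqxx ltnS leq_eqVlt val_eqE /=.
    have [->|bk] := eqVneq b k; first by rewrite ltnn add0r mulr1.
    by rewrite mulr0 addr0.
  rewrite addrA.
  have [|s sh ->] := @line_mvt _ _ f (u + trunc h k) (e_ k) (h 0 k).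
    by move=> s /trU[/= + _] => /(fD k).
  rewrite -mulrBr normrM ler_pM ?row_entry_le // distrC.
  by have [_] := trU _ sh; exact.
have tel : f (h + u) - f u - gradL f u h =
    \sum_(k < m) (f (u + trunc h k.+1) - f (u + trunc h k) - h 0 k * pd k f u).
  rewrite sumrB /= /grad; congr (_ - _).
  rewrite -(big_mkord xpredT (fun k => f (u + trunc h k.+1) - f (u + trunc h k))).
  rewrite telescope_sumr //; congr (f _ - f _); last first.
    by rewrite (_ : trunc h 0 = 0) ?addr0 //; apply/rowP => b; rewrite !mxE.
  by rewrite addrC; congr (_ + _); apply/rowP => b; rewrite !mxE ltn_ord.
rewrite tel; apply: le_trans (ler_norm_sum _ _ _) _.
apply: le_trans (ler_sum _ (fun k _ => step k)) _.
rewrite sumr_const card_ord -mulr_natr /e' mulrC [`|h| * _]mulrC.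
have -> : m%:R * (e / m.+1%:R * `|h|) = e * `|h| * (m%:R / m.+1%:R) by ring.
rewrite ler_piMr ?mulr_ge0 ?(ltW e0) //.
by rewrite ler_pdivrMr ?ltr0n // mul1r ler_nat.
Qed.

End C1.

(** * Calculus of functions of class C^k *)

Section SmoothFunctions.
Variables (R : realType) (m : nat).
Implicit Types (U : set 'rV[R]_m) (f g : 'rV[R]_m -> R) (u : 'rV[R]_m).
Local Notation e_ a := (delta_mx 0 a : 'rV[R]_m).

Lemma Ck_continuous k U f u : Ck k U f -> U u -> {for u, continuous f}.
Proof. by case: k => [|k] [cf _] /cf. Qed.

Lemma Ck_derivable k U f u a : Ck k.+1 U f -> U u -> derivable f u (e_ a).
Proof. by move=> [_ /(_ a) [df _]] /df. Qed.
Arguments Ck_derivable [k U f u] a _ _.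

Lemma Ck_pd k U f a : Ck k.+1 U f -> Ck k U (pd a f).
Proof. by move=> [_ /(_ a) []]. Qed.

Lemma CkW k U f : Ck k.+1 U f -> Ck k U f.
Proof.
elim: k f => [|k IH] f [cf df]; first by split.
by split=> // a; have [da Ca] := df a; split=> //; exact: IH.
Qed.

Lemma smooth_continuous U f u : smooth U f -> U u -> {for u, continuous f}.
Proof. by move=> /(_ 0%N); exact: Ck_continuous. Qed.

Lemma smooth_derivable U f u a : smooth U f -> U u -> derivable f u (e_ a).
Proof. by move=> /(_ 1%N); exact: Ck_derivable. Qed.
Arguments smooth_derivable [U f u] a _ _.

Lemma smooth_pd U f a : smooth U f -> smooth U (pd a f).
Proof. by move=> sf k; exact/Ck_pd/sf. Qed.

Lemma Ck_subset k U U' f : U' `<=` U -> Ck k U f -> Ck k U' f.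
Proof.
move=> UU'; elim: k f => [|k IH] f [cf df]; split => //; try by move=> u /UU' /cf.
move=> a; have [da Ca] := df a; by split=> [u /UU' /da //|]; exact: IH.
Qed.

Lemma smooth_subset U U' f : U' `<=` U -> smooth U f -> smooth U' f.
Proof. by move=> UU' sf k; exact/(Ck_subset UU')/sf. Qed.

Lemma open_near_eq U f g u : open U -> U u -> (forall x, U x -> f x = g x) ->
  \near u, f u = g u.
Proof.
move=> Uo Uu fg; have : nbhs u U by exact: open_nbhs_nbhs.
by apply: filterS => x /fg.
Qed.

Lemma pd_eq U f g u a : open U -> U u -> (forall x, U x -> f x = g x) ->
  pd a f u = pd a g u.
Proof. by move=> Uo Uu fg; apply/near_eq_derive/(open_near_eq Uo Uu fg). Qed.

Lemma continuous_near_eq U f g u : open U -> U u -> (forall x, U x -> f x = g x) ->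
  {for u, continuous f} -> {for u, continuous g}.
Proof.
move=> Uo Uu fg; rewrite /prop_for /continuous_at (fg u Uu) => cf.
have E : \near u, f u = g u := open_near_eq Uo Uu fg.
exact: cvg_trans (near_eq_cvg E) cf.
Qed.

(** Partial derivatives depend on a neighbourhood, hence the openness of [U]. The closure properties
    below compute a derivative on [U] only and replace it by means of this lemma. *)
Lemma Ck_eq k U f g : open U -> (forall x, U x -> f x = g x) -> Ck k U f -> Ck k U g.
Proof.
move=> Uo; elim: k f g => [|k IH] f g fg [cf df].
  by split=> // u Uu; exact: continuous_near_eq fg (cf u Uu).
split=> [u Uu|a]; first exact: continuous_near_eq fg (cf u Uu).
have [da Ca] := df a; split=> [u Uu|].
  by apply: near_eq_derivable (da u Uu); exact: (open_near_eq Uo Uu).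
by apply: IH Ca => x Ux; exact: pd_eq fg.
Qed.

Lemma smooth_eq U f g : open U -> (forall x, U x -> f x = g x) -> smooth U f -> smooth U g.
Proof. by move=> Uo fg sf k; exact: Ck_eq (sf k). Qed.

Lemma Ck_cst k U (c : R) : Ck k U (fun=> c).
Proof.
elim: k c => [|k IH] c; split=> //; try by move=> u _; exact: cst_continuous.
move=> a; split=> [u _|]; first exact: derivable_cst.
by rewrite (_ : pd a _ = fun=> 0) //; apply/funext => u; exact: derive_cst.
Qed.

Lemma CkD k U f g : open U -> Ck k U f -> Ck k U g -> Ck k U (fun u => f u + g u).
Proof.
move=> Uo; elim: k f g => [|k IH] f g Cf Cg.
  by split=> // u Uu; apply: continuousD; [exact: Cf.1|exact: Cg.1].
split=> [u Uu|a]; first by apply: continuousD; [exact: Cf.1|exact: Cg.1].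
split=> [u Uu|]; first exact: derivableD (Ck_derivable a Cf Uu) (Ck_derivable a Cg Uu).
apply: Ck_eq (IH _ _ (Ck_pd a Cf) (Ck_pd a Cg)) => // x Ux /=.
by rewrite /pd [RHS]deriveD //; [exact: (Ck_derivable a Cf Ux)|exact: (Ck_derivable a Cg Ux)].
Qed.

Lemma CkM k U f g : open U -> Ck k U f -> Ck k U g -> Ck k U (fun u => f u * g u).
Proof.
move=> Uo; elim: k f g => [|k IH] f g Cf Cg.
  by split=> // u Uu; apply: continuousM; [exact: Cf.1|exact: Cg.1].
split=> [u Uu|a]; first by apply: continuousM; [exact: Cf.1|exact: Cg.1].
split=> [u Uu|]; first exact: derivableM (Ck_derivable a Cf Uu) (Ck_derivable a Cg Uu).
have := CkD Uo (IH _ _ (CkW Cf) (Ck_pd a Cg)) (IH _ _ (CkW Cg) (Ck_pd a Cf)).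
apply: Ck_eq => // x Ux /=.
by rewrite /pd [RHS]deriveM //; [exact: (Ck_derivable a Cf Ux)|exact: (Ck_derivable a Cg Ux)].
Qed.

Lemma smooth_cst U (c : R) : smooth U (fun=> c).
Proof. by move=> k; exact: Ck_cst. Qed.

Lemma smoothD U f g : open U -> smooth U f -> smooth U g -> smooth U (fun u => f u + g u).
Proof. by move=> Uo sf sg k; exact: CkD. Qed.

Lemma smoothM U f g : open U -> smooth U f -> smooth U g -> smooth U (fun u => f u * g u).
Proof. by move=> Uo sf sg k; exact: CkM. Qed.

Lemma smoothN U f : open U -> smooth U f -> smooth U (fun u => - f u).
Proof.
move=> Uo sf; have := smoothM Uo (smooth_cst U (-1)) sf.
by apply: smooth_eq => // x _; rewrite mulN1r.
Qed.

Lemma smoothB U f g : open U -> smooth U f -> smooth U g -> smooth U (fun u => f u - g u).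
Proof. by move=> Uo sf sg; exact/smoothD/smoothN. Qed.

Lemma Ck_sum k U (I : Type) (r : seq I) (P : pred I) (F : I -> 'rV[R]_m -> R) : open U ->
  (forall i, Ck k U (F i)) -> Ck k U (fun u => \sum_(i <- r | P i) F i u).
Proof.
move=> Uo CF; elim: r => [|i r IH].
  by rewrite (_ : (fun _ => _) = fun=> 0); [exact: Ck_cst|apply/funext => u; rewrite big_nil].
case Pi : (P i).
  by apply: Ck_eq (CkD Uo (CF i) IH) => // u _; rewrite big_cons Pi.
by apply: Ck_eq IH => // u _; rewrite big_cons Pi.
Qed.

Lemma smooth_sum U (I : Type) (r : seq I) (P : pred I) (F : I -> 'rV[R]_m -> R) : open U ->
  (forall i, smooth U (F i)) -> smooth U (fun u => \sum_(i <- r | P i) F i u).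
Proof. by move=> Uo sF k; apply: Ck_sum => // i; exact: sF. Qed.

(** The derivative of [1/f] is [- f' / f^2], again a product involving [1/f], so order [k] of the
    claim feeds order [k + 1]. *)
Lemma CkV k U f : open U -> (forall u, U u -> f u != 0) ->
  Ck k U f -> Ck k U (fun u => (f u)^-1).
Proof.
move=> Uo f0; elim: k => [|k IH] Cf.
  by split=> // u Uu; apply: continuousV; [exact: f0|exact: Cf.1].
split=> [u Uu|a]; first by apply: continuousV; [exact: f0|exact: Cf.1].
split=> [u Uu|]; first exact: derivableV (f0 u Uu) (Ck_derivable a Cf Uu).
have CV := IH (CkW Cf).
have := CkM Uo (Ck_cst k U (-1)) (CkM Uo (CkM Uo CV CV) (Ck_pd a Cf)).
apply: Ck_eq => // x Ux /=.
rewrite /pd [RHS]deriveV ?f0 //; last exact: (Ck_derivable a Cf Ux).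
by rewrite mulN1r -[_ *: _]/(_ * _) -exprVn expr2 mulNr.
Qed.

Lemma smoothV U f : open U -> (forall u, U u -> f u != 0) ->
  smooth U f -> smooth U (fun u => (f u)^-1).
Proof. by move=> Uo f0 sf k; exact: CkV. Qed.

End SmoothFunctions.

(** * Chain rule, composition and the exponential *)

Section ChainRule.
Variables (R : realType) (n : nat).
Implicit Types (U W : set 'rV[R]_n) (f g : 'rV[R]_n -> R) (u : 'rV[R]_n).
Local Notation e_ a := (delta_mx 0 a).

Lemma Ck_diff k U f u : open U -> U u -> Ck k.+1 U f ->
  differentiable f u /\ forall h, 'd f u h = \sum_a h 0 a * pd a f u.
Proof.
move=> Uo Uu Cf; apply: (C1_diff Uo Uu) => a x Ux; first exact: Ck_derivable Cf Ux.
exact: Ck_continuous (Ck_pd a Cf) Ux.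
Qed.

Lemma diff_row (V : normedModType R) (phi : V -> 'rV[R]_n) v :
  (forall b, differentiable (fun x => phi x 0 b) v) -> differentiable phi v.
Proof.
move=> dphi; have -> : phi = \sum_b (fun x => phi x 0 b *: e_ b).
  by apply/funext => x; rewrite fct_sumE [LHS]row_sum_delta.
by apply: differentiable_sum => b; apply: differentiableZl.
Qed.

(** The source is an arbitrary normed space because both changes of coordinates and curves, such as
    the rays of the Poincare lemma, are inserted into [f]. *)
Lemma chain_rule (V : normedModType R) (phi : V -> 'rV[R]_n) k W f v w :
  open W -> W (phi v) -> Ck k.+1 W f ->
  (forall b, differentiable (fun x => phi x 0 b) v) ->
  differentiable (fun x => f (phi x)) v /\
  'D_w (fun x => f (phi x)) v =
    \sum_b 'D_w (fun x => phi x 0 b) v * pd b f (phi v).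
Proof.
move=> Wo Wv Cf dphi; have [df dfE] := Ck_diff Wo Wv Cf.
have dp := diff_row dphi.
have dfp : differentiable (f \o phi) v by exact: differentiable_comp.
split=> //; rewrite [LHS](deriveE _ dfp) diff_comp //= dfE.
apply: eq_bigr => b _; congr (_ * _).
rewrite -deriveE // derive_mx ?mxE //; exact: diff_derivable.
Qed.

End ChainRule.

Section SmoothComposition.
Variables (R : realType) (m n : nat).
Local Notation e_ a := (delta_mx 0 a).

Lemma continuous_row (T : topologicalType) (phi : T -> 'rV[R]_n) x :
  (forall b, {for x, continuous (fun y => phi y 0 b)}) -> {for x, continuous phi}.
Proof.
move=> cphi; apply/cvgrPdist_le => e e0.
have /filter_forall : forall b, \forall y \near x, `|phi x 0 b - phi y 0 b| <= e.
  by move=> b; have /cvgrPdist_le/(_ _ e0) := cphi b.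
by apply: filterS => y H; apply: row_norm_le (ltW e0) _ => b; rewrite !mxE.
Qed.

(** By the chain rule a partial derivative is a sum of products in which [f] is replaced by
    [pd b f], one order lower; the induction is therefore over all [f]. *)
Lemma Ck_comp k (U : set 'rV[R]_m) (W : set 'rV[R]_n) (phi : 'rV[R]_m -> 'rV[R]_n) f :
  open U -> open W -> (forall x, U x -> W (phi x)) ->
  (forall b, Ck k U (fun x => phi x 0 b)) -> Ck k W f -> Ck k U (fun x => f (phi x)).
Proof.
move=> Uo Wo UW; elim: k f => [|k IH] f Cphi Cf.
  split=> // u Uu; apply: (@continuous_comp _ _ _ phi f).
    by apply: continuous_row => b; have [/(_ u Uu)] := Cphi b.
  by have [/(_ _ (UW u Uu))] := Cf.
have cr u v : U u -> _ := fun Uu => chain_rule v Wo (UW u Uu) Cf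
  (fun b => (Ck_diff Uo Uu (Cphi b)).1).
split=> [u Uu|a].
  by apply: differentiable_continuous; have [] := cr u 0 Uu.
split=> [u Uu|].
  by apply: diff_derivable; have [] := cr u 0 Uu.
have : Ck k U (fun u => \sum_b pd a (fun x => phi x 0 b) u * pd b f (phi u)).
  apply: Ck_sum => // b; apply: CkM => //; first exact: Ck_pd (Cphi b).
  by apply: IH (Ck_pd b Cf) => c; exact: CkW.
by apply: Ck_eq => // u Uu; have [_] := cr u (e_ a) Uu => <-.
Qed.

End SmoothComposition.

Section SmoothExp.
Variables (R : realType) (m : nat).
Implicit Types (U : set 'rV[R]_m) (f : 'rV[R]_m -> R) (u : 'rV[R]_m).
Local Notation e_ a := (delta_mx 0 a).

Lemma expR_chain_rule (V : normedModType R) (f : V -> R) (u v : V) : differentiable f u ->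
  differentiable (fun x => expR (f x)) u /\
  'D_v (fun x => expR (f x)) u = 'D_v f u * expR (f u).
Proof.
move=> df; have de : differentiable (@expR R) (f u).
  exact/derivable1_diffP/derivable_expR.
have dc : differentiable (expR \o f) u by exact: differentiable_comp.
split=> //; rewrite [LHS](deriveE _ dc) diff_comp //= -deriveE //.
rewrite -[in LHS]deriveE // -[X in 'D_X expR _]mulr1 -[_ * 1]/(_ *: _).
by rewrite deriveE // linearZ /= -deriveE // derive_val.
Qed.

Lemma Ck_expR k U f : open U -> Ck k U f -> Ck k U (fun u => expR (f u)).
Proof.
move=> Uo; elim: k => [|k IH] Cf.
  split=> // u Uu; apply: (@continuous_comp _ _ _ f (@expR R)); first exact: Cf.1.
  exact: continuous_expR.
have de u v (Uu : U u) := expR_chain_rule v (Ck_diff Uo Uu Cf).1.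
split=> [u Uu|a]; first by apply: differentiable_continuous; have [] := de u 0 Uu.
split=> [u Uu|]; first by apply: diff_derivable; have [] := de u 0 Uu.
have := CkM Uo (Ck_pd a Cf) (IH (CkW Cf)).
by apply: Ck_eq => // u Uu; have [_] := de u (e_ a) Uu => <-.
Qed.

Lemma smooth_expR U f : open U -> smooth U f -> smooth U (fun u => expR (f u)).
Proof. by move=> Uo sf k; exact: Ck_expR. Qed.

End SmoothExp.

(** * Symmetry of second derivatives *)

Section Schwarz.
Variables (R : realType) (m : nat).
Implicit Types (U : set 'rV[R]_m) (f : 'rV[R]_m -> R) (u : 'rV[R]_m).
Local Notation e_ a := (delta_mx 0 a : 'rV[R]_m).

Lemma is_derive_translate f v w x : derivable f (x + w) v ->
  is_derive x v (fun y => f (y + w)) ('D_v f (x + w)).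
Proof.
have E : (fun h : R => h^-1 *: (((fun y => f (y + w)) \o shift x) (h *: v)
            - f (x + w))) =
         (fun h => h^-1 *: ((f \o shift (x + w)) (h *: v) - f (x + w))).
  by apply/funext => h /=; rewrite addrA.
move=> df; split; first by rewrite /derivable E.
by rewrite /derive E.
Qed.

(* The second difference is symmetric in [a] and [b]; hence Schwarz's theorem. *)
Lemma second_difference_mvt U f u a b t : Ck 2 U f -> 
  (forall s s', `|s| <= `|t| -> `|s'| <= `|t| -> U (u + s *: e_ a + s' *: e_ b)) ->
  exists s s', [/\ `|s| <= `|t|, `|s'| <= `|t| &
    f (u + t *: e_ a + t *: e_ b) - f (u + t *: e_ a) - f (u + t *: e_ b) + f u
    = t * (t * pd b (pd a f) (u + s *: e_ a + s' *: e_ b))].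
Proof.
move=> Cf HU; pose g x := f (x + t *: e_ b) - f x.
have HU0 s : `|s| <= `|t| -> U (u + s *: e_ a).
  by move=> st; have := HU s 0 st; rewrite scale0r addr0 normr0; exact.
have dg s : `|s| <= `|t| -> is_derive (u + s *: e_ a) (e_ a) g
    (pd a f (u + s *: e_ a + t *: e_ b) - pd a f (u + s *: e_ a)).
  move=> st; apply: is_deriveB; last first.
    by apply: derivableP; apply: Ck_derivable Cf _; exact: HU0.
  by apply: is_derive_translate; apply: Ck_derivable Cf _; exact: HU.
have [s st E] : exists2 s, `|s| <= `|t| &
    g (u + t *: e_ a) - g u = t * 'D_(e_ a) g (u + s *: e_ a).
  by apply: line_mvt => s /dg [].
have [s' st' E'] : exists2 s', `|s'| <= `|t| &
    pd a f (u + s *: e_ a + t *: e_ b) - pd a f (u + s *: e_ a) =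
    t * pd b (pd a f) (u + s *: e_ a + s' *: e_ b).
  by apply: line_mvt => s' st'; apply: Ck_derivable (Ck_pd a Cf) _; exact: HU.
exists s, s'; split=> //; rewrite -E'.
have [_ <-] := dg s st; rewrite -E /g; ring.
Qed.

Lemma pdC U f u a b : open U -> U u -> Ck 2 U f ->
  pd a (pd b f) u = pd b (pd a f) u.
Proof.
move=> Uo Uu Cf; apply/eqP; rewrite -subr_eq0 -normr_le0; apply/ler_addgt0Pl => e e0.
have tri (x y z : R) : `|x - z| <= e / 2 -> `|y - z| <= e / 2 -> `|x - y| <= e.
  move=> xz yz; have -> : x - y = (x - z) - (y - z) by ring.
  apply: le_trans (ler_normB _ _) _; lra.
rewrite addr0; pose P x := U x /\ (`|pd a (pd b f) u - pd a (pd b f) x| <= e / 2 /\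
  `|pd b (pd a f) u - pd b (pd a f) x| <= e / 2).
have e20 : 0 < e / 2 by rewrite divr_gt0.
have nP : \forall x \near u, P x.
  have nU : nbhs u U by exact: open_nbhs_nbhs.
  have /cvgrPdist_le/(_ _ e20) nab := Ck_continuous (Ck_pd a (Ck_pd b Cf)) Uu.
  have /cvgrPdist_le/(_ _ e20) nba := Ck_continuous (Ck_pd b (Ck_pd a Cf)) Uu.
  exact: (filterI nU (filterI nab nba)).
have [d /= d0 Hd] := (nbhs_ballP _ _).1 nP.
(* Two steps of length at most [t] end within [2 d / 3], hence inside the ball of radius [d]. *)
pose t := d / 3.
have t0 : 0 < t by rewrite divr_gt0.
have H c c' s s' : `|s| <= `|t| -> `|s'| <= `|t| -> P (u + s *: e_ c + s' *: e_ c').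
  move=> st st'; apply: Hd; rewrite -ball_normE /= -addrA opprD addNKr normrN.
  have le1 c'' r : `|r *: e_ c''| <= `|r|.
    apply: row_norm_le => // k; rewrite !mxE eqxx /=.
    by case: eqP => _; rewrite ?mulr1 // mulr0 normr0.
  apply: le_lt_trans (ler_normD _ _) _.
  apply: le_lt_trans (lerD (le1 _ _) (le1 _ _)) _.
  apply: le_lt_trans (lerD st st') _.
  rewrite gtr0_norm // /t; lra.
have HU c c' s s' : `|s| <= `|t| -> `|s'| <= `|t| -> U (u + s *: e_ c + s' *: e_ c').
  by move=> st st'; have [] := H c c' s s' st st'.
have [s [s' [st st' E]]] := second_difference_mvt Cf (HU a b).
have [r [r' [rt rt' F]]] := second_difference_mvt Cf (HU b a).
have [_ [_ H1]] := H a b s s' st st'.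
have [_ [H2 _]] := H b a r r' rt rt'.
have {E F} : pd b (pd a f) (u + s *: e_ a + s' *: e_ b)
    = pd a (pd b f) (u + r *: e_ b + r' *: e_ a).
  apply: (mulfI (lt0r_neq0 t0)); apply: (mulfI (lt0r_neq0 t0)).
  apply: etrans (esym E) (etrans _ F).
  by rewrite (addrAC u) [in LHS](addrAC (f _)).
move=> E; rewrite E in H1.
exact: tri H2 H1.
Qed.

End Schwarz.

Section LocallyConstant.
Variables (R : realType) (m : nat).
Local Notation e_ a := (delta_mx 0 a : 'rV[R]_m).

Lemma ball_segment (u x : 'rV[R]_m) r (s : R) : ball u r x -> `|s| <= 1 ->
  ball u r (u + s *: (x - u)).
Proof.
rewrite -ball_normE /= opprD addNKr normrN normrZ => xr s1.
by apply: le_lt_trans xr; rewrite distrC ler_piMl.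
Qed.

Lemma pd0_cst_ball (f : 'rV[R]_m -> R) u r x : 
  Ck 1 (ball u r) f -> (forall y a, ball u r y -> pd a f y = 0) ->
  ball u r x -> f x = f u.
Proof.
move=> Cf f0 ux; have Bo : open (ball u r) by exact: ball_open.
have df s : `|s| <= 1 -> differentiable f (u + s *: (x - u)) /\
    'D_(x - u) f (u + s *: (x - u)) = 0.
  move=> s1; have bs := ball_segment ux s1.
  have [d dE] := Ck_diff Bo bs Cf; split=> //.
  by rewrite deriveE // dE big1 // => a _; rewrite f0 // mulr0.
have [s|s] := @line_mvt _ _ f u (x - u) 1.
  by rewrite normr1 => /df[d _]; exact: diff_derivable.
rewrite normr1 => /df[_ ->]; rewrite mulr0 scale1r addrCA subrr addr0.
by move/eqP; rewrite subr_eq0 => /eqP.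
Qed.

End LocallyConstant.

(** * Closed 1-forms on a ball *)

Section PoincareLemma.
Variables (R : realType) (m : nat) (u0 : 'rV[R]_m) (r : R).
Variable theta : 'I_m -> 'rV[R]_m -> R.
Local Notation e_ a := (delta_mx 0 a : 'rV[R]_m).
Local Notation B := (ball u0 r).
Local Notation mu := (@lebesgue_measure R).
Hypothesis theta_C1 : forall a, Ck 1 B (theta a).
Hypothesis theta_closed : forall x a b, B x -> pd a (theta b) x = pd b (theta a) x.

Let ray (x : 'rV[R]_m) (t : R) := u0 + t *: (x - u0).
Let B_open : open B. Proof. exact: ball_open. Qed.

(** Integrand of the radial homotopy operator: its integral over [[0, 1]] is the integral of [theta]
    along the segment from [u0] to [x]. *)
Let phi x t := \sum_b (x - u0) 0 b * theta b (ray x t).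
(* By closedness, the derivative of [phi x t] in the direction [e_ a]; it is
   the derivative of [t * theta a (ray x t)] in [t]. *)
Let dphi a x t := theta a (ray x t) +
  t * \sum_b (x - u0) 0 b * pd b (theta a) (ray x t).

(** A closed ball of the sup norm is a product of segments, hence compact. The bound serves to
    dominate the derivative of the integrand when differentiating under the integral sign. *)
Lemma compact_ball_bounded (f : 'rV[R]_m -> R) r' : r' < r ->
  (forall x, B x -> {for x, continuous f}) ->
  exists2 M, 0 <= M & forall x, `|x - u0| <= r' -> `|f x| <= M.
Proof.
move=> rr' cf; pose K := [set v : 'rV[R]_m | forall i, v ord0 i \in `[u0 0 i - r', u0 0 i + r']].
have [r'0|r'0] := ltP r' 0.
  by exists 0 => // x xr; have := le_lt_trans xr r'0; rewrite normr_lt0.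
have KP x : K x <-> `|x - u0| <= r'.
  rewrite /K /=; split=> H.
    apply: row_norm_le => // k; have := H k; rewrite in_itv /= !mxE ler_norml.
    by case/andP => h1 h2; apply/andP; split; lra.
  move=> k; have := le_trans (row_entry_le _ k) H; rewrite !mxE in_itv /= ler_norml.
  by case/andP => h1 h2; apply/andP; split; lra.
have cK : compact K.
  apply: (@rV_compact _ m (fun i => [set` `[u0 0 i - r', u0 0 i + r']])) => i.
  exact: segment_compact.
have cfK : {within K, continuous f}.
  apply: continuous_in_subspaceT => x /set_mem /KP xr; apply: cf.
  by rewrite -ball_normE /= distrC (le_lt_trans xr).
have /compact_bounded[M [_ HM]] := continuous_compact cfK cK.
exists (`|M| + 1); first by rewrite addr_ge0.
move=> x /KP Kx; apply: (HM (`|M| + 1)); last by exists x.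
by rewrite (le_lt_trans (ler_norm _)) // ltrDl.
Qed.

Let ray_ball x t : B x -> `|t| <= 1 -> B (ray x t).
Proof. exact: ball_segment. Qed.

Let is_derive_affine (V : normedModType R) (g : V -> R) (c k : R) (x v : V) dg :
  is_derive x v g dg -> is_derive x v (fun y => c + k * g y) (k * dg).
Proof.
move=> dgx; have := is_deriveD (is_derive_cst c x v) (is_deriveZ k dgx).
by rewrite add0r.
Qed.

Let coord_derive a (x : 'rV[R]_m) b :
  is_derive x (e_ a) (fun x : 'rV[R]_m => x 0 b) ((a == b)%:R).
Proof.
have d : differentiable (fun x : 'rV[R]_m => x 0 b) x by exact: differentiable_coord.
split; first exact: diff_derivable.
have /= E := derive_mx (@derivable_id R _ x (e_ a)).
have := congr1 (fun z : 'rV[R]_m => z 0 b) E.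
by rewrite /= mxE derive_id !mxE eqxx /= eq_sym => ->.
Qed.

Let ray_diff (x : 'rV[R]_m) (t : R) b :
  is_derive t 1 (fun t => ray x t 0 b) ((x - u0) 0 b).
Proof.
have -> : (fun t => ray x t 0 b) = (fun t => u0 0 b + (x - u0) 0 b * t).
  by apply/funext => s; rewrite !mxE mulrC.
by have := is_derive_affine (u0 0 b) ((x - u0) 0 b) (is_derive_id t 1); rewrite mulr1.
Qed.

Let ray_diff_pt t a (x : 'rV[R]_m) b :
  is_derive x (e_ a) (fun x => ray x t 0 b) (t * (a == b)%:R).
Proof.
have -> : (fun x => ray x t 0 b) = (fun x => (u0 0 b - t * u0 0 b) + t * x 0 b).
  by apply/funext => s; rewrite !mxE; ring.
exact/is_derive_affine/coord_derive.
Qed.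

Let ray_differentiable_pt t (x : 'rV[R]_m) b : differentiable (fun x => ray x t 0 b) x.
Proof.
have -> : (fun x => ray x t 0 b) = (fun x => u0 0 b + t *: (x 0 b - u0 0 b)).
  by apply/funext => s; rewrite !mxE.
apply: differentiableD; first exact: differentiable_cst.
apply: differentiableZ; apply: differentiableB; last exact: differentiable_cst.
exact: differentiable_coord.
Qed.

Let theta_ray a (x : 'rV[R]_m) (t : R) : B x -> `|t| <= 1 ->
  is_derive t 1 (fun t => theta a (ray x t))
    (\sum_b (x - u0) 0 b * pd b (theta a) (ray x t)).
Proof.
move=> Bx t1.
have rd b : differentiable (fun t => ray x t 0 b) t.
  by apply/derivable1_diffP; have [] := ray_diff x t b.
have [d E] := @chain_rule _ _ _ (ray x) 0%N B (theta a) t 1 B_open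
  (ray_ball Bx t1) (theta_C1 a) rd.
split; first exact: diff_derivable.
by rewrite E; apply: eq_bigr => b _; have [_ ->] := ray_diff x t b.
Qed.

Let dphi_primitive a (x : 'rV[R]_m) (t : R) : B x -> `|t| <= 1 ->
  is_derive t 1 (fun t => t * theta a (ray x t)) (dphi a x t).
Proof.
move=> Bx t1; have := is_deriveM (is_derive_id t 1) (theta_ray a Bx t1).
by rewrite /dphi addrC -[_ *: 1]/(_ * _) mulr1.
Qed.

Let phi_derive a (x : 'rV[R]_m) (t : R) : B x -> `|t| <= 1 ->
  is_derive x (e_ a) (phi ^~ t) (dphi a x t).
Proof.
move=> Bx t1.
have d b : is_derive x (e_ a) (fun x => (x - u0) 0 b * theta b (ray x t))
   ((x - u0) 0 b * (t * pd b (theta a) (ray x t)) + theta b (ray x t) * (a == b)%:R).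
  have [d E] := @chain_rule _ _ _ (ray^~ t) 0%N B (theta b) x (e_ a) B_open
    (ray_ball Bx t1) (theta_C1 b) (ray_differentiable_pt t x).
  have d1 : is_derive x (e_ a) (fun x => theta b (ray x t)) (t * pd b (theta a) (ray x t)).
    split; first exact: diff_derivable.
    rewrite E (bigD1 a) //= (@derive_val _ _ _ _ _ _ _ (ray_diff_pt t a x a)).
    rewrite eqxx mulr1 big1 ?addr0 => [|c ca]; last first.
      rewrite (@derive_val _ _ _ _ _ _ _ (ray_diff_pt t a x c)).
      by rewrite eq_sym (negbTE ca) mulr0 mul0r.
    by rewrite theta_closed //; exact: ray_ball.
  have d2 : is_derive x (e_ a) (fun x : 'rV[R]_m => (x - u0) 0 b) (a == b)%:R.
    have -> : (fun x : 'rV[R]_m => (x - u0) 0 b) = (fun x => - u0 0 b + 1 * x 0 b).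
      by apply/funext => y; rewrite !mxE mul1r addrC.
    by have := is_derive_affine (- u0 0 b) 1 (coord_derive a x b); rewrite mul1r.
  exact: is_deriveM d2 d1.
have := is_derive_sum d.
have -> : \sum_(i < m) (fun x => (x - u0) 0 i * theta i (ray x t)) = phi ^~ t.
  by apply/funext => y; rewrite fct_sumE.
congr (is_derive _ _ _ _); rewrite /dphi big_split /= addrC; congr (_ + _).
  rewrite (bigD1 a) //= eqxx mulr1 big1 ?addr0 // => c ca.
  by rewrite eq_sym (negbTE ca) mulr0.
by rewrite mulr_sumr; apply: eq_bigr => b _; rewrite mulrCA.
Qed.

Let pot (x : 'rV[R]_m) : R := \int[mu]_(t in `[0, 1]) phi x t.

Let unit_itv (t : R) : t \in `[0, 1] -> `|t| <= 1.
Proof. by rewrite in_itv /= => /andP[t0 t1]; rewrite ger0_norm. Qed.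

Let phi_within x : B x -> {within `[0, 1], continuous (phi x)}.
Proof.
move=> Bx; apply: derivable_within_continuous => t /unit_itv t1.
have d b : is_derive t 1 (fun t => (x - u0) 0 b *: theta b (ray x t)) _ :=
  is_deriveZ _ (theta_ray b Bx t1).
have [] := is_derive_sum d.
have -> // : \sum_(i < m) (fun t => (x - u0) 0 i *: theta i (ray x t)) = phi x.
by apply/funext => y; rewrite fct_sumE.
Qed.

Let ray_continuous x : continuous (ray x).
Proof.
move=> t; apply: continuous_row => b; apply/differentiable_continuous/derivable1_diffP.
by have [] := ray_diff x t b.
Qed.

Let dphi_within a x : B x -> {within `[0, 1], continuous (dphi a x)}.
Proof.
move=> Bx; apply: continuous_in_subspaceT => t; rewrite inE => /unit_itv t1.
have cr (f : 'rV[R]_m -> R) : (forall y, B y -> {for y, continuous f}) ->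
    {for t, continuous (fun t => f (ray x t))}.
  move=> cf; apply: (@continuous_comp _ _ _ (ray x) f); first exact: ray_continuous.
  exact/cf/ray_ball.
pose S (t : R) := \sum_b (x - u0) 0 b * pd b (theta a) (ray x t).
apply: (@continuousD _ _ _ (fun t : R => theta a (ray x t)) (fun t => t * S t)).
  by apply: cr => y; exact: (Ck_continuous (theta_C1 a)).
apply: (@continuousM _ _ id S) => //; apply: continuous_sumr => b.
apply: continuousM; first exact: cst_continuous.
by apply: cr => y; exact: (Ck_continuous (Ck_pd b (theta_C1 a))).
Qed.

(** The ray reaches [x] at [t = 1], and the factor [t] of the antiderivative kills the contribution
    of [t = 0]. *)
Let dphi_integral a x : B x -> \int[mu]_(t in `[0, 1]) dphi a x t = theta a x.
Proof.
move=> Bx; rewrite /Rintegral.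
pose F (t : R) := t * theta a (ray x t).
have dF (t : R) : t \in `[0, 1] -> is_derive t 1 F (dphi a x t).
  by move=> /unit_itv; exact: dphi_primitive.
have cF (t : R) : t \in `[0, 1] -> F s @[s --> t] --> F t.
  move=> /dF[d _]; apply: differentiable_continuous; exact/derivable1_diffP.
rewrite (@continuous_FTC2 _ _ F) //.
- by rewrite /F /= mul1r mul0r subr0 /ray scale1r addrC subrK.
- exact: dphi_within.
- split.
  + by move=> t /subset_itv_oo_cc/dF[].
  + by apply: cvg_at_right_filter; apply: cF; rewrite in_itv /= lexx ler01.
  + by apply: cvg_at_left_filter; apply: cF; rewrite in_itv /= lexx ler01.
- by move=> t /subset_itv_oo_cc/dF[_]; rewrite derive1E.
Qed.

Let dphi_bounded a r' : r' < r ->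
  exists2 M, 0 <= M & forall x (t : R), `|x - u0| <= r' -> t \in `[0, 1] -> `|dphi a x t| <= M.
Proof.
move=> rr'.
have [M0 M00 H0] := compact_ball_bounded rr' (fun y => Ck_continuous (theta_C1 a)).
have H b : exists2 M, 0 <= M & forall x, `|x - u0| <= r' -> `|pd b (theta a) x| <= M.
  exact: compact_ball_bounded rr' (fun y => Ck_continuous (Ck_pd b (theta_C1 a))).
pose M b := sval (cid2 (H b)).
have M_ge0 b : 0 <= M b by rewrite /M; case: cid2.
have HM b x : `|x - u0| <= r' -> `|pd b (theta a) x| <= M b.
  by rewrite /M; case: cid2 => /= ? _; exact.
exists (M0 + \sum_b `|r'| * M b).
  by rewrite addr_ge0 ?sumr_ge0 // => b _; rewrite mulr_ge0.
move=> x t xr t01; have t1 := unit_itv t01.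
have rayr : `|ray x t - u0| <= r'.
  by rewrite /ray addrAC subrr add0r normrZ (le_trans _ xr) // ler_piMl.
apply: le_trans (ler_normD _ _) _; apply: lerD; first exact: H0.
rewrite normrM; apply: (@le_trans _ _ `|\sum_b (x - u0) 0 b * pd b (theta a) (ray x t)|).
  by rewrite ler_piMl.
apply: le_trans (ler_norm_sum _ _ _) _; apply: ler_sum => b _.
rewrite normrM; apply: ler_pM => //; last exact: HM.
apply: le_trans (row_entry_le _ b) _; exact: le_trans xr (ler_norm _).
Qed.

Let pot_derive a x : B x -> is_derive x (e_ a) pot (theta a x).
Proof.
move=> Bx; have xr : `|x - u0| < r by move: Bx; rewrite -ball_normE /= distrC.
(* Half of the room left in the ball: the points [x + s *: e_ a] with [|s| < d] stay in a strictly
   smaller closed ball, where a single constant dominates. *)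
pose d := (r - `|x - u0|) / 2; have d0 : 0 < d by rewrite divr_gt0 // subr_gt0.
have rr' : `|x - u0| + d < r by rewrite /d; lra.
have xs (s : R) : s \in `]- d, d[ -> `|x + s *: e_ a - u0| <= `|x - u0| + d.
  rewrite in_itv /= => /andP[s1 s2]; rewrite addrAC.
  apply: le_trans (ler_normD _ _) _; rewrite lerD2l.
  apply: row_norm_le => [|k]; first exact: ltW.
  rewrite !mxE eqxx /=; case: eqP => _; last by rewrite mulr0 normr0 ltW.
  by rewrite mulr1 ler_norml !ltW.
have xB s : s \in `]- d, d[ -> B (x + s *: e_ a).
  by move=> /xs sd; rewrite -ball_normE /= distrC (le_lt_trans sd).
pose f (s t : R) := phi (x + s *: e_ a) t.
have df (s t : R) : s \in `]- d, d[ -> t \in `[0, 1] ->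
    is_derive s 1 (f^~ t) (dphi a (x + s *: e_ a) t).
  move=> sd /unit_itv t1; have [D <-] := phi_derive a (xB s sd) t1.
  exact: is_derive_line.
have [M M0 HM] := dphi_bounded a rr'.
have z0 : `]- d, d[%classic (0 : R) by rewrite /= in_itv /= oppr_lt0 d0.
have := @cvg_differentiation_under_integral R _ _ mu f `[0, 1]%classic
  (measurable_itv _) 0 (- d) d z0 _ _ (fun=> M) _ _ _.
have pE (s t : R) : s \in `]- d, d[ -> t \in `[0, 1] ->
    partial1of2 f s t = dphi a (x + s *: e_ a) t.
  by move=> sd td; rewrite partial1of2E; have [_] := df s t sd td.
have -> : \int[mu]_(y in `[0, 1]) partial1of2 f 0 y = theta a x.
  rewrite -[RHS](dphi_integral a Bx); apply: eq_Rintegral => t /set_mem /= td.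
  by rewrite pE // scale0r addr0.
have -> : (fun h : R => h^-1 *: (\int[mu]_(y in `[0, 1]) f (h + 0) y
      - \int[mu]_(y in `[0, 1]) f 0 y))
  = (fun h : R => h^-1 *: (pot (h *: e_ a + x) - pot x)).
  by apply/funext => h; rewrite /f /pot addr0 scale0r addr0 [h *: _ + x]addrC.
move=> H; have {}H : h^-1 *: (pot (h *: e_ a + x) - pot x) @[h --> 0^'] --> theta a x.
  apply: H.
  - move=> s sd; apply: continuous_compact_integrable; first exact: segment_compact.
    exact/phi_within/xB.
  - by move=> s t sd td; have [] := df s t sd td.
  - by move=> _; exact: M0.
  - apply: continuous_compact_integrable; first exact: segment_compact.
    by move=> t; exact: cst_continuous.
  - by move=> s t sd td; rewrite pE //; apply: HM => //; exact: xs.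
by apply: DeriveDef; [apply/cvg_ex; exists (theta a x)|exact/cvg_lim].
Qed.

Lemma closed_1form_primitive : exists f : 'rV[R]_m -> R,
  forall x a, B x -> derivable f x (e_ a) /\ pd a f x = theta a x.
Proof. by exists pot => x a Bx; have [d E] := pot_derive a Bx. Qed.

End PoincareLemma.

(** The integral only uses that [theta] is C^1; smoothness of the primitive is then read off its
    partial derivatives, which are the [theta a]. *)
Lemma smooth_primitive (R : realType) (m : nat) (u0 : 'rV[R]_m) (r : R)
    (theta : 'I_m -> 'rV[R]_m -> R) :
  (forall a, smooth (ball u0 r) (theta a)) ->
  (forall x a b, ball u0 r x -> pd a (theta b) x = pd b (theta a) x) ->
  exists2 f, smooth (ball u0 r) f &
    forall x a, ball u0 r x -> pd a f x = theta a x.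
Proof.
move=> sth cth; have Bo : open (ball u0 r) by exact: ball_open.
have [f fP] := closed_1form_primitive (fun a => sth a 1%N) cth.
exists f => [k|x a Bx]; last by have [] := fP x a Bx.
have fC x : ball u0 r x -> {for x, continuous f}.
  move=> Bx; apply: differentiable_continuous.
  apply: (C1_diff Bo Bx _ _).1 => a y By; first by have [] := fP y a By.
  have := smooth_continuous (sth a) By.
  by apply: (continuous_near_eq Bo By) => z Bz; have [] := fP z a Bz.
case: k => [|k]; split=> // a; split; first by move=> x /(fP _ a)[].
by apply: Ck_eq (sth a k) => // x /(fP _ a)[].
Qed.

(** * Linear algebra of a two-form and a complex structure *)

Section Contraction.
Variables (R : realType) (m : nat).
Implicit Types (J W : 'M[R]_m) (T : 'I_m -> 'M[R]_m) (v w z : 'rV[R]_m).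

Lemma skew_entry W a b : W^T = - W -> W a b = - W b a.
Proof. by move=> /matrixP/(_ b a); rewrite !mxE. Qed.

Lemma invmx_contract W a b : W \in unitmx -> \sum_c invmx W a c * W c b = (a == b)%:R.
Proof. by move=> /mulVmx/matrixP/(_ a b); rewrite !mxE. Qed.

Lemma contract_invmx W a b : W \in unitmx -> \sum_c W a c * invmx W c b = (a == b)%:R.
Proof. by move=> /mulmxV/matrixP/(_ a b); rewrite !mxE. Qed.

Lemma sum_delta_l (f : 'I_m -> R) a : \sum_b (a == b)%:R * f b = f a.
Proof.
rewrite (bigD1 a) //= eqxx mul1r big1 ?addr0 // => b ba.
by rewrite eq_sym (negbTE ba) mul0r.
Qed.

Lemma sum_delta_r (f : 'I_m -> R) a : \sum_b (b == a)%:R * f b = f a.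
Proof. by rewrite -[RHS]sum_delta_l; apply: eq_bigr => b _; rewrite eq_sym. Qed.

Lemma contract_self W : W \in unitmx -> W^T = - W ->
  \sum_a \sum_b invmx W a b * W a b = - m%:R.
Proof.
move=> Wu Ws; transitivity (\sum_(a < m) (-1 : R)); last first.
  by rewrite sumr_const card_ord mulNrn.
apply: eq_bigr => a _; transitivity (- \sum_b invmx W a b * W b a).
  by rewrite -sumrN; apply: eq_bigr => b _; rewrite (skew_entry a b Ws) mulrN.
by rewrite invmx_contract // eqxx.
Qed.

(* The left-hand side is a contraction of [theta /\ W] with the inverse of [W]. *)
Lemma theta_wedge_trace W (theta : 'I_m -> R) c : W \in unitmx -> W^T = - W ->
  \sum_a \sum_b invmx W a b *
     (theta a * W b c + theta b * W c a + theta c * W a b) = (2 - m%:R) * theta c.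
Proof.
move=> Wu Ws.
transitivity (\sum_a theta a * (\sum_b invmx W a b * W b c)
   + \sum_b theta b * (\sum_a W c a * invmx W a b)
   + theta c * \sum_a \sum_b invmx W a b * W a b).
  under [X in _ + X + _]eq_bigr do rewrite mulr_sumr.
  rewrite [X in _ + X + _]exchange_big /= mulr_sumr -!big_split /=.
  apply: eq_bigr => a _; rewrite !mulr_sumr -!big_split /=.
  by apply: eq_bigr => b _; ring.
rewrite contract_self //.
under eq_bigr do rewrite invmx_contract // mulrC.
rewrite sum_delta_r; under eq_bigr do rewrite contract_invmx // mulrC.
by rewrite sum_delta_l; ring.
Qed.

(** The cyclic sum of an alternating form [tau] is [3 tau]. Tracefreeness removes it from the
    contraction, leaving [(2 - m) theta c = 0]; with [theta] gone, [3 tau = 0] remains. *)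
Lemma theta_wedge_torsion W T (theta : 'I_m -> R) : (2 < m)%N ->
  W \in unitmx -> W^T = - W -> lambda30 W T ->
  (forall a b c, theta a * W b c + theta b * W c a + theta c * W a b
     + ((T a *m W) b c + (T b *m W) c a + (T c *m W) a b) = 0) ->
  (forall a, theta a = 0) /\ (forall a, T a = 0).
Proof.
move=> m2 Wu Ws [T1 T2 T3] H.
have tauE a b c : (T b *m W) c a = (T a *m W) b c /\ (T c *m W) a b = (T a *m W) b c.
  by split; [rewrite T2 T1 opprK|rewrite T1 T2 opprK].
have th0 c : theta c = 0.
  have := theta_wedge_trace theta c Wu Ws.
  have -> : \sum_a \sum_b invmx W a b *
     (theta a * W b c + theta b * W c a + theta c * W a b) =
     - 3 * \sum_a \sum_b invmx W a b * (T a *m W) b c.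
    rewrite mulr_sumr; apply: eq_bigr => a _; rewrite mulr_sumr; apply: eq_bigr => b _.
    have := H a b c; have [-> ->] := tauE a b c => /eqP.
    by rewrite addr_eq0 => /eqP ->; ring.
  rewrite T3 mulr0 => /esym/eqP; rewrite mulf_eq0 => /orP[|/eqP //].
  by rewrite subr_eq0 eqr_nat => /eqP m2E; rewrite -m2E in m2.
split=> // a; apply: (can_inj (mulmxK Wu)); rewrite mul0mx.
apply/matrixP => b c; rewrite [RHS]mxE; have := H a b c.
have [-> ->] := tauE a b c; rewrite !th0 !mul0r !addr0 add0r => H3.
by lra.
Qed.

(** The long hypothesis is [F /\ W = 0]. Contracted with the inverse of [W], the term
    [F a b * W c d] gives [- m F], the four mixed terms give [F] each, and the last one gives [t W]
    with [t] the trace of [F]. Contracting [(4 - m) F + t W = 0] once more gives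
    [2 (2 - m) t = 0]. *)
Lemma two_form_wedge0 W (F : 'I_m -> 'I_m -> R) : (4 < m)%N ->
  W \in unitmx -> W^T = - W -> (forall a b, F a b = - F b a) ->
  (forall a b c d, F a b * W c d + F a c * W d b + F a d * W b c
     + F c d * W a b + F d b * W a c + F b c * W a d = 0) ->
  forall a b, F a b = 0.
Proof.
move=> m4 Wu Ws Fs H.
pose t := \sum_c \sum_d invmx W c d * F c d.
have E a b : (4 - m%:R) * F a b + t * W a b = 0.
  transitivity (\sum_c \sum_d invmx W c d * (F a b * W c d + F a c * W d b + F a d * W b c
     + F c d * W a b + F d b * W a c + F b c * W a d)); last first.
    by rewrite big1 // => c _; rewrite big1 // => d _; rewrite H mulr0.
  transitivity (F a b * (\sum_c \sum_d invmx W c d * W c d)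
    + \sum_c F a c * (\sum_d invmx W c d * W d b)
    + \sum_d F a d * (\sum_c W b c * invmx W c d)
    + t * W a b
    + \sum_d F d b * (\sum_c W a c * invmx W c d)
    - \sum_c F b c * (\sum_d invmx W c d * W d a)).
    rewrite contract_self //.
    under [X in _ = _ + X + _ + _ + _ - _]eq_bigr do rewrite invmx_contract // mulrC.
    under [X in _ = _ + X + _ + _ - _]eq_bigr do rewrite contract_invmx // mulrC.
    under [X in _ = _ + X - _]eq_bigr do rewrite contract_invmx // mulrC.
    under [X in _ = _ - X]eq_bigr do rewrite invmx_contract // mulrC.
    by rewrite !sum_delta_r !sum_delta_l (Fs b a); ring.
  under [X in _ + _ + X + _ + _ - _]eq_bigr do rewrite mulr_sumr.
  under [X in _ + X - _]eq_bigr do rewrite mulr_sumr.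
  rewrite [X in _ + _ + X + _ + _ - _]exchange_big [X in _ + X - _]exchange_big /=.
  rewrite mulr_sumr /t mulr_suml -sumrN -!big_split /=.
  apply: eq_bigr => c _; rewrite !mulr_sumr mulr_suml -sumrN -!big_split /=.
  by apply: eq_bigr => d _; rewrite (skew_entry a d Ws); ring.
have t0 : t = 0.
  have : (4 - m%:R) * t + t * (\sum_a \sum_b invmx W a b * W a b) = 0.
    rewrite /t !mulr_sumr -big_split big1 // => a _ /=.
    rewrite !mulr_sumr -big_split big1 // => b _ /=.
    by rewrite [X in X + _]mulrCA [X in _ + X]mulrCA -mulrDr E mulr0.
  rewrite contract_self // => /eqP.
  have -> : (4 - m%:R) * t + t * - m%:R = 2 * (2 - m%:R) * t by ring.
  rewrite !mulf_eq0 pnatr_eq0 /= => /orP[|/eqP //].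
  by rewrite subr_eq0 eqr_nat => /eqP m2E; rewrite -m2E in m4.
move=> a b; have /eqP := E a b; rewrite t0 mul0r addr0 mulf_eq0 => /orP[|/eqP //].
by rewrite subr_eq0 eqr_nat => /eqP m2E; rewrite -m2E in m4.
Qed.

End Contraction.

(** * Tensors of type (0,2) and alternating tracefree forms *)

Section Type02.
Variables (R : realType) (m : nat).
Implicit Types (J W : 'M[R]_m) (T : 'I_m -> 'M[R]_m) (v w z : 'rV[R]_m).
Local Notation e_ a := (delta_mx 0 a : 'rV[R]_m).

Lemma eval12_delta T a b : eval12 T (e_ a) (e_ b) = row b (T a).
Proof.
rewrite /eval12 (bigD1 a) //= mxE !eqxx scale1r -rowE big1 ?addr0 // => c ca.
by rewrite mxE eqxx (negbTE ca) scale0r.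
Qed.

Lemma eval12_inj T T' : (forall v w, eval12 T v w = eval12 T' v w) -> forall a, T a = T' a.
Proof.
move=> H a; apply/row_matrixP => b; rewrite -!eval12_delta; exact: H.
Qed.

Lemma eval12Nl T v w : eval12 T (- v) w = - eval12 T v w.
Proof. by rewrite /eval12 -sumrN; apply: eq_bigr => a _; rewrite mxE scaleNr. Qed.

Lemma eval12Nr T v w : eval12 T v (- w) = - eval12 T v w.
Proof. by rewrite /eval12 -sumrN; apply: eq_bigr => a _; rewrite mulNmx scalerN. Qed.

Lemma eval12D T T' v w : eval12 (fun a => T a + T' a) v w = eval12 T v w + eval12 T' v w.
Proof.
rewrite /eval12 -big_split /=; apply: eq_bigr => a _.
by rewrite mulmxDr scalerDr.
Qed.

Lemma eval12Z T k v w : eval12 (fun a => k *: T a) v w = k *: eval12 T v w.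
Proof.
rewrite /eval12 scaler_sumr; apply: eq_bigr => a _.
by rewrite -scalemxAr !scalerA mulrC.
Qed.

Lemma eval12_mul T J v w : eval12 (fun a => T a *m J) v w = eval12 T v w *m J.
Proof.
rewrite /eval12 mulmx_suml; apply: eq_bigr => a _.
by rewrite mulmxA scalemxAl.
Qed.

Lemma eval12_mulr T J v w : eval12 (fun a => J *m T a) v w = eval12 T v (w *m J).
Proof. by rewrite /eval12; apply: eq_bigr => a _; rewrite mulmxA. Qed.

Lemma eval12_mull T J v w :
  eval12 (fun a => \sum_r J a r *: T r) v w = eval12 T (v *m J) w.
Proof.
rewrite /eval12; under [RHS]eq_bigr do rewrite mxE scaler_suml.
rewrite exchange_big /=; apply: eq_bigr => a _; rewrite mulmx_sumr scaler_sumr.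
by apply: eq_bigr => b _; rewrite -scalemxAr scalerA.
Qed.

(** Components of [proj02 J T]: the sum over [r] inserts [J] into the first argument, a factor [J]
    on the left inserts it into the second one, and a factor on the right applies it to the
    value. *)
Definition mx02 J T a : 'M[R]_m := T a - J *m (\sum_r J a r *: T r)
  + (\sum_r J a r *: T r) *m J + J *m T a *m J.

Lemma eval12_mx02 J T v w : eval12 (mx02 J T) v w = proj02 J T v w.
Proof.
rewrite /mx02 /proj02 eval12D eval12D eval12_mul eval12_mull.
rewrite (eval12_mul (fun a => J *m T a)) eval12_mulr; congr (_ + _ + _).
transitivity (eval12 (fun a => T a + (-1) *: (J *m (\sum_r J a r *: T r))) v w).
  by rewrite /eval12; apply: eq_bigr => a _; rewrite scaleN1r.
rewrite eval12D eval12Z (eval12_mulr (fun a => \sum_r J a r *: T r)).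
by rewrite eval12_mull scaleN1r.
Qed.

Lemma mulmx_JJ J v : J *m J = - 1%:M -> v *m J *m J = - v.
Proof. by move=> JJ; rewrite -mulmxA JJ mulmxN mulmx1. Qed.

Lemma mx02_type02 J T : J *m J = - 1%:M ->
  (forall v w, eval12 T v w = - eval12 T w v) -> type02 J (mx02 J T).
Proof.
move=> JJ Ts v w; rewrite !eval12_mx02 /proj02 !(mulmx_JJ _ JJ).
rewrite !(eval12Nl, eval12Nr) !mulmxDl !mulNmx !(mulmx_JJ _ JJ).
rewrite (Ts w v) (Ts (w *m J) (v *m J)) (Ts (w *m J) v) (Ts w (v *m J)) !mulNmx.
split; apply/rowP => k; rewrite !mxE; ring.
Qed.

(** Each of the four terms of [proj02] equals [T(v, w)] when [T] is conjugate linear in both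
    arguments; this is the origin of the factor 4. *)
Lemma proj02_type02 J T v w : J *m J = - 1%:M -> type02 J T ->
  proj02 J T v w = 4 *: eval12 T v w.
Proof.
move=> JJ T02; rewrite /proj02.
have [_ E1 _] := T02 v (w *m J); have [_ E2 E3] := T02 v w.
rewrite E1 E2 E3 !mulNmx !(mulmx_JJ _ JJ) opprK.
apply/rowP => k; rewrite !mxE; ring.
Qed.

Lemma proj02D J T T' v w :
  proj02 J (fun a => T a + T' a) v w = proj02 J T v w + proj02 J T' v w.
Proof.
rewrite /proj02 !eval12D !mulmxDl; apply/rowP => k.
set x1 := eval12 T v w; set x2 := eval12 T _ _; set x3 := eval12 T _ _ *m J.
set x4 := eval12 T _ _ *m J.
by rewrite !mxE; ring.
Qed.

Lemma proj02Z J T k v w : proj02 J (fun a => k *: T a) v w = k *: proj02 J T v w.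
Proof. by rewrite /proj02 !eval12Z -!scalemxAl !scalerDr scalerN. Qed.

(** The form [tau] of [lambda30] on arbitrary vectors; basis vectors are not enough once [J] is
    inserted into the arguments. *)
Definition tri W T v w z : R := (eval12 T v w *m W *m z^T) 0 0.

Definition tri_mx W T z : 'M[R]_m := \matrix_(a, b) tri W T (e_ a) (e_ b) z.

Lemma eval12_sum T v w : eval12 T v w = \sum_a \sum_b (v 0 a * w 0 b) *: row b (T a).
Proof.
rewrite /eval12; apply: eq_bigr => a _; rewrite mulmx_sum_row scaler_sumr.
by apply: eq_bigr => b _; rewrite scalerA.
Qed.

Lemma tri_mxE W T v w z : tri W T v w z = (v *m tri_mx W T z *m w^T) 0 0.
Proof.
rewrite /tri eval12_sum -mulmxA mulmx_suml summxE mxE.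
under [RHS]eq_bigr do rewrite !mxE mulr_suml.
rewrite exchange_big /=; apply: eq_bigr => a _; rewrite mulmx_suml summxE.
apply: eq_bigr => b _; rewrite -scalemxAl !mxE /tri eval12_delta -mulmxA mulrAC.
by rewrite !mxE mulrC [RHS]mulrC mulrC.
Qed.

Lemma tri_delta W T a b c : tri W T (e_ a) (e_ b) (e_ c) = (T a *m W) b c.
Proof.
rewrite /tri eval12_delta trmx_delta -row_mul.
by rewrite -colE !mxE.
Qed.

Lemma skew_form (N : 'M[R]_m) v w : N^T = - N ->
  (v *m N *m w^T) 0 0 = - (w *m N *m v^T) 0 0.
Proof.
move=> Ns; have /matrixP/(_ 0 0) : (v *m N *m w^T)^T = - (w *m N *m v^T).
  by rewrite !trmx_mul trmxK Ns mulNmx mulmxN mulmxA.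
by rewrite [LHS]mxE => ->; rewrite mxE.
Qed.

Lemma tri_mx_skew W T z : lambda30 W T -> (tri_mx W T z)^T = - tri_mx W T z.
Proof.
move=> [T1 _ _]; apply/matrixP => a b; rewrite !mxE /tri !eval12_delta -!row_mul.
rewrite !mxE -sumrN; apply: eq_bigr => c _.
by rewrite !mxE -mulNr; congr (_ * _); have := T1 b a c; rewrite !mxE.
Qed.

Lemma tri_altl W T v w z : lambda30 W T -> tri W T v w z = - tri W T w v z.
Proof. by move=> /tri_mx_skew H; rewrite !tri_mxE skew_form. Qed.

Lemma tri_altr W T v w z : lambda30 W T -> tri W T v w z = - tri W T v z w.
Proof.
move=> [_ T2 _]; rewrite /tri /eval12 !mulmx_suml !summxE -sumrN.
apply: eq_bigr => a _; rewrite -!scalemxAl [LHS]mxE [in RHS]mxE -mulrN.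
congr (_ * _); rewrite -!mulmxA 2!(mulmxA (T a)) !(mulmxA _ (T a *m W)).
by apply: skew_form; apply/matrixP => b c; rewrite mxE [RHS]mxE T2.
Qed.

Lemma lambda30_tri W T :
  (forall v w z, tri W T v w z = - tri W T w v z) ->
  (forall v w z, tri W T v w z = - tri W T v z w) ->
  (forall c, \tr ((invmx W)^T *m tri_mx W T (e_ c)) = 0) -> lambda30 W T.
Proof.
move=> H1 H2 H3; split=> [a b c|a b c|c].
- by rewrite -!tri_delta H1.
- by rewrite -!tri_delta H2.
- rewrite -[RHS](H3 c) /mxtrace exchange_big /=; apply: eq_bigr => b _.
  rewrite [RHS]mxE; apply: eq_bigr => a _.
  by rewrite -tri_delta [X in _ = X * _]mxE [X in _ = _ * X]mxE.
Qed.

Lemma tr_sym_skew (S N : 'M[R]_m) : S^T = S -> N^T = - N -> \tr (S *m N) = 0.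
Proof.
move=> Ss Ns; have : \tr (S *m N) = - \tr (S *m N).
  rewrite -[LHS]mxtrace_tr trmx_mul Ss Ns mulNmx linearN /=.
  by rewrite mxtrace_mulC.
by move=> E; lra.
Qed.

(** As [J] is skew for [W], a [J] applied to the value moves to the third argument with a minus
    sign. The resulting formula treats the three arguments alike, which is why the projection
    preserves alternating forms. *)
Lemma tri_mx02 J W T v w z : J *m J = - 1%:M -> J *m W *m J^T = W ->
  tri W (mx02 J T) v w z = tri W T v w z - tri W T (v *m J) (w *m J) z
    - tri W T (v *m J) w (z *m J) - tri W T v (w *m J) (z *m J).
Proof.
move=> JJ JW; have JWE : J *m W = - (W *m J^T).
  by rewrite -[in RHS]JW -mulmxA -trmx_mul JJ linearN /= trmx1 mulmxN mulmx1 opprK.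
rewrite /tri eval12_mx02 /proj02 !mulmxDl !mulNmx -!(mulmxA _ J W) JWE trmx_mul.
rewrite !mulmxN !mulNmx !mulmxA.
set x1 := _ *m z^T; set x2 := _ *m z^T; set x3 := _ *m z^T; set x4 := _ *m z^T.
by rewrite !mxE.
Qed.

(** Alternation follows from [tri_mx02]. For the trace, the inverse of [W] is [J]-invariant, so
    inserting [J] into both traced arguments does not change the trace and these two terms cancel.
    In the other two terms, [J] turns the inverse of [W] into a symmetric matrix, whose trace
    against a skew one vanishes. *)
Lemma lambda30_mx02 J W T : J *m J = - 1%:M -> J *m W *m J^T = W ->
  W \in unitmx -> W^T = - W -> lambda30 W T -> lambda30 W (mx02 J T).
Proof.
move=> JJ JW Wu Ws LT.
have A1 v w z := tri_altl v w z LT; have A2 v w z := tri_altr v w z LT.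
apply: lambda30_tri => [v w z|v w z|c].
- rewrite !tri_mx02 // (A1 w v) (A1 (w *m J) (v *m J)) (A1 (w *m J) v) (A1 w (v *m J)).
  ring.
- rewrite !tri_mx02 // (A2 v z) (A2 (v *m J) (z *m J)) (A2 (v *m J) z) (A2 v (z *m J)).
  ring.
set V := (invmx W)^T.
have VW : V *m W = - 1%:M.
  by rewrite -[W in _ *m W]opprK -Ws mulmxN -trmx_mul mulmxV // trmx1.
have VWt : V *m W^T = 1%:M by rewrite -trmx_mul mulmxV // trmx1.
have Vs : V^T = - V.
  by apply: (can_inj (mulmxK Wu)); rewrite mulNmx VW opprK trmxK mulVmx.
have JtJt : J^T *m J^T = - 1%:M by rewrite -trmx_mul JJ linearN /= trmx1.
have JW' : J *m W^T = - (W^T *m J^T).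
  have E : J *m W = - (W *m J^T).
    by rewrite -[in RHS]JW -mulmxA JtJt mulmxN mulmx1 opprK.
  by rewrite Ws mulmxN mulNmx E.
have JV : J^T *m V *m J = V.
  apply: (can_inj (mulmxK (_ : W^T \in unitmx))); first by rewrite unitmx_tr.
  by rewrite -(mulmxA _ J) JW' mulmxN !mulmxA -(mulmxA _ V) VWt mulmx1 JtJt opprK.
have VJ : V *m J = - (J^T *m V).
  by rewrite -[in LHS]JV -(mulmxA _ J) JJ mulmxN mulmx1.
have VJs : (V *m J)^T = V *m J by rewrite trmx_mul Vs mulmxN VJ.
have JVs : (J^T *m V)^T = J^T *m V by rewrite trmx_mul Vs trmxK mulNmx VJ opprK.
pose N := tri_mx W T (e_ c); pose N' := tri_mx W T (e_ c *m J).
have E : tri_mx W (mx02 J T) (e_ c) = N - J *m N *m J^T - J *m N' - N' *m J^T.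
  apply/matrixP => a b; rewrite [LHS]mxE tri_mx02 // !tri_mxE -/N -/N'.
  have ent (P : 'M[R]_m) : (e_ a *m P *m (e_ b)^T) 0 0 = P a b.
    by rewrite -rowE trmx_delta -colE !mxE.
  have -> : e_ a *m J *m N *m (e_ b *m J)^T = e_ a *m (J *m N *m J^T) *m (e_ b)^T.
    by rewrite trmx_mul !mulmxA.
  have -> : e_ a *m N' *m (e_ b *m J)^T = e_ a *m (N' *m J^T) *m (e_ b)^T.
    by rewrite trmx_mul !mulmxA.
  rewrite -(mulmxA (e_ a) J N') !ent.
  by set x1 := J *m N *m _; set x2 := J *m N'; set x3 := N' *m _; rewrite !mxE.
have Ns z : (tri_mx W T z)^T = - tri_mx W T z by exact: tri_mx_skew.
have trB (P Q : 'M[R]_m) : \tr (P - Q) = \tr P - \tr Q by rewrite linearB.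
rewrite E !mulmxBr !trB.
have -> : \tr (V *m (J *m N *m J^T)) = \tr (V *m N).
  by rewrite !mulmxA mxtrace_mulC !mulmxA JV.
have -> : \tr (V *m (J *m N')) = 0.
  by rewrite mulmxA; exact: tr_sym_skew VJs (Ns _).
have -> : \tr (V *m (N' *m J^T)) = 0.
  by rewrite mulmxA mxtrace_mulC mulmxA; exact: tr_sym_skew JVs (Ns _).
by rewrite subrr !subr0.
Qed.

End Type02.

(** * The algebra behind [dtheta /\ W = 0] *)

Section WedgeAlgebra.
Variables (R : realType) (m : nat).

(* [P] and [Q] stand for the first derivatives of [W] and [theta], and [H] for
   the second derivatives of [W]; the relation [dW = theta /\ W] and its
   derivative give [dtheta /\ W = 0]. *)
Lemma dtheta_wedge_eq0 (H : 'I_m -> 'I_m -> 'I_m -> 'I_m -> R) (P : 'I_m -> 'I_m -> 'I_m -> R)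
    (Q W : 'I_m -> 'I_m -> R) (theta : 'I_m -> R) a b c d :
  (forall d a b c, H d a b c = H a d b c) -> (forall d a b c, H d a b c = - H d a c b) ->
  (forall a b c, P a b c = - P a c b) -> (forall b c, W b c = - W c b) ->
  (forall a b c, P a b c + P b c a + P c a b
    = theta a * W b c + theta b * W c a + theta c * W a b) ->
  (forall d a b c, H d a b c + H d b c a + H d c a b
    = Q d a * W b c + theta a * P d b c + (Q d b * W c a + theta b * P d c a)
      + (Q d c * W a b + theta c * P d a b)) ->
  let F x y := Q x y - Q y x in
  F a b * W c d + F a c * W d b + F a d * W b c
     + F c d * W a b + F d b * W a c + F b c * W a d = 0.
Proof.
move=> Hsym Hs Ps Ws E dE F; rewrite /F.
(* The four cyclic instances of [dE] are combined: the symmetric second derivatives cancel, and the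
   terms [theta /\ dW] become [theta /\ theta /\ W = 0] by the multiples of [E]. The rewriting below
   sorts indices, so that only a linear identity between monomials remains. *)
have e1 := dE d a b c; have e2 := dE a b c d; have e3 := dE b c d a; have e4 := dE c d a b.
have Ea := congr1 (fun z => theta a * z) (E d b c).
have Eb := congr1 (fun z => theta b * z) (E d a c).
have Ec := congr1 (fun z => theta c * z) (E d a b).
have Ed := congr1 (fun z => theta d * z) (E a b c).
move: e1 e2 e3 e4 Ea Eb Ec Ed.
rewrite ?(Ws b a) ?(Ws c a) ?(Ws d a) ?(Ws c b) ?(Ws d b) ?(Ws d c).
rewrite ?(Ps _ b a) ?(Ps _ c a) ?(Ps _ d a) ?(Ps _ c b) ?(Ps _ d b) ?(Ps _ d c).
rewrite ?(Hs _ _ b a) ?(Hs _ _ c a) ?(Hs _ _ d a) ?(Hs _ _ c b) ?(Hs _ _ d b) ?(Hs _ _ d c).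
rewrite ?(Hsym b a) ?(Hsym c a) ?(Hsym d a) ?(Hsym c b) ?(Hsym d b) ?(Hsym d c).
clear; lra.
Qed.

End WedgeAlgebra.

(** * Torsion, Nijenhuis tensor and exterior derivative in a chart *)

Section MatrixCalculus.
Variables (R : realType) (m : nat).
Implicit Types (U : set 'rV[R]_m) (f g : 'rV[R]_m -> R) (F G J : 'rV[R]_m -> 'M[R]_m)
  (u : 'rV[R]_m) (X Y : 'rV[R]_m -> 'rV[R]_m).
Local Notation e_ a := (delta_mx 0 a : 'rV[R]_m).

Definition derivable_at f u := forall a, derivable f u (e_ a).

Lemma smooth_derivable_at U f u : smooth U f -> U u -> derivable_at f u.
Proof. by move=> sf Uu a; exact: smooth_derivable sf Uu. Qed.

Lemma pdM f g u a : derivable_at f u -> derivable_at g u ->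
  pd a (fun x => f x * g x) u = pd a f u * g u + f u * pd a g u.
Proof.
move=> df dg; apply: etrans (deriveM (df a) (dg a)) _.
by rewrite addrC; congr (_ + _); exact: mulrC.
Qed.

Lemma derivable_atM f g u : derivable_at f u -> derivable_at g u ->
  derivable_at (fun x => f x * g x) u.
Proof. by move=> df dg a; exact: derivableM (df a) (dg a). Qed.

Lemma pd_sum n (f : 'I_n -> 'rV[R]_m -> R) u a : (forall i, derivable_at (f i) u) ->
  pd a (fun x => \sum_i f i x) u = \sum_i pd a (f i) u.
Proof.
move=> df; rewrite /pd -derive_sum => [|i]; last exact: df.
by congr ('D_ _ _ _); apply/funext => x; rewrite fct_sumE.
Qed.

Lemma derivable_at_sum n (f : 'I_n -> 'rV[R]_m -> R) u : (forall i, derivable_at (f i) u) ->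
  derivable_at (fun x => \sum_i f i x) u.
Proof.
have -> : (fun x => \sum_i f i x) = \sum_i f i by apply/funext => x; rewrite fct_sumE.
by move=> df a; apply: derivable_sum => i; exact: df.
Qed.

Lemma pd_cst (c : R) u a : pd a (fun=> c) u = 0.
Proof. exact: derive_cst. Qed.

Lemma derivable_at_cst (c : R) u : derivable_at (fun=> c) u.
Proof. by move=> a; exact: derivable_cst. Qed.

Lemma pd_expR f u a : differentiable f u ->
  pd a (fun x => expR (f x)) u = pd a f u * expR (f u).
Proof. by move=> df; have [_] := expR_chain_rule (delta_mx 0 a) df. Qed.

Lemma pdD f g u a : derivable_at f u -> derivable_at g u ->
  pd a (fun x => f x + g x) u = pd a f u + pd a g u.
Proof. by move=> df dg; exact: deriveD. Qed.

Lemma derivable_atD f g u : derivable_at f u -> derivable_at g u ->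
  derivable_at (fun x => f x + g x) u.
Proof. by move=> df dg a; exact: derivableD (df a) (dg a). Qed.

Lemma pdZ f (k : R) u a : derivable_at f u -> pd a (fun x => k * f x) u = k * pd a f u.
Proof. by move=> df; rewrite (pdM _ (@derivable_at_cst k u) df) pd_cst mul0r add0r. Qed.

Lemma pdN f u a : derivable_at f u -> pd a (fun x => - f x) u = - pd a f u.
Proof. by move=> df; rewrite /pd [LHS]deriveN. Qed.

Definition covd (Gam : 'I_m -> 'M[R]_m) (v : 'rV[R]_m) Y u : 'rV[R]_m :=
  \sum_a v 0 a *: (\row_b pd a (fun x => Y x 0 b) u + Y u *m Gam a).

Definition tors (Gam : 'I_m -> 'M[R]_m) a : 'M[R]_m :=
  \matrix_(b, c) (Gam a b c - Gam b a c).

(** The invariant description of the torsion. It holds for arbitrary coefficients [Gam] at the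
    point, as the terms with [Gam] cancel against [tors Gam]. *)
Lemma lie_covd (Gam : 'I_m -> 'M[R]_m) X Y u :
  lie X Y u = covd Gam (X u) Y u - covd Gam (Y u) X u - eval12 (tors Gam) (X u) (Y u).
Proof.
apply/rowP => c; rewrite /covd /eval12 [LHS]mxE [RHS]mxE [X in X + _]mxE.
rewrite [X in _ = _ + X + _]mxE [X in _ = _ + X]mxE !summxE.
have E : \sum_a Y u 0 a * (X u *m Gam a) 0 c = \sum_a X u 0 a * \sum_b Y u 0 b * Gam b a c.
  under eq_bigr do rewrite mxE mulr_sumr.
  rewrite exchange_big /=; apply: eq_bigr => a _; rewrite mulr_sumr.
  by apply: eq_bigr => b _; rewrite mulrCA.
have F a (Z : 'rV[R]_m -> 'rV[R]_m) k :
    (k *: (\row_b pd a (fun x => Z x 0 b) u + Z u *m Gam a)) 0 c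
    = k * pd a (fun x => Z x 0 c) u + k * (Z u *m Gam a) 0 c.
  by rewrite [LHS]mxE [X in k * X]mxE [X in k * (X + _)]mxE mulrDr.
rewrite (eq_bigr _ (fun a _ => F a Y (X u 0 a))) (eq_bigr _ (fun a _ => F a X (Y u 0 a))).
have S0 : \sum_a X u 0 a * (Y u *m Gam a) 0 c - \sum_a X u 0 a * (\sum_b Y u 0 b * Gam b a c)
    - \sum_k (X u 0 k *: (Y u *m tors Gam k)) 0 c = 0.
  rewrite -!sumrB big1 // => a _.
  have -> : (X u 0 a *: (Y u *m tors Gam a)) 0 c = X u 0 a * (Y u *m tors Gam a) 0 c.
    by rewrite mxE.
  rewrite [(Y u *m Gam a) 0 c]mxE [(Y u *m tors Gam a) 0 c]mxE.
  rewrite -!mulrBr.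
  have -> : \sum_j Y u 0 j * tors Gam a j c
      = \sum_j Y u 0 j * Gam a j c - \sum_j Y u 0 j * Gam j a c.
    by rewrite -sumrB; apply: eq_bigr => j _; rewrite mxE mulrBr.
  by rewrite subrr mulr0.
rewrite !big_split /= E sumrN.
set S1 := \sum_i _ in S0 *; set S2 := \sum_i _ in S0 *; set S3 := \sum_i _ in S0 *.
set A := \sum_i _; set B := \sum_i _.
have -> : A + S1 - (B + S2) - S3 = A - B + (S1 - S2 - S3) by ring.
by rewrite S0 addr0.
Qed.

Lemma covd_app (Gam : 'I_m -> 'M[R]_m) v J Y u :
  (forall b c, derivable_at (fun x => J x b c) u) ->
  (forall b, derivable_at (fun x => Y x 0 b) u) ->
  (forall a, dmx a J u + J u *m Gam a - Gam a *m J u = 0) ->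
  covd Gam v (app J Y) u = covd Gam v Y u *m J u.
Proof.
move=> dJ dY cJ; rewrite /covd mulmx_suml; apply: eq_bigr => a _.
rewrite -scalemxAl; congr (_ *: _); rewrite mulmxDl /app -!mulmxA.
have -> : Gam a *m J u = dmx a J u + J u *m Gam a.
  by apply/esym/eqP; rewrite -subr_eq0 cJ.
rewrite mulmxDr addrA; congr (_ + _); apply/rowP => b; rewrite !mxE.
transitivity (pd a (fun x => \sum_j Y x 0 j * J x j b) u).
  by congr (pd _ _ _); apply/funext => x; rewrite mxE.
rewrite pd_sum => [|j]; last exact: derivable_atM.
by rewrite -big_split; apply: eq_bigr => j _ /=; rewrite pdM // !mxE.
Qed.

(** Each bracket is expressed by covariant derivatives. As [J] is parallel and has square [- 1%:M],
    the derivative terms cancel in pairs, and the four torsion terms are those of [proj02]. *)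
Lemma nijenhuis_torsion (Gam : 'I_m -> 'M[R]_m) J X Y u : J u *m J u = - 1%:M ->
  (forall b c, derivable_at (fun x => J x b c) u) ->
  (forall b, derivable_at (fun x => X x 0 b) u) ->
  (forall b, derivable_at (fun x => Y x 0 b) u) ->
  (forall a, dmx a J u + J u *m Gam a - Gam a *m J u = 0) ->
  nijenhuis J X Y u = - proj02 (J u) (tors Gam) (X u) (Y u).
Proof.
move=> JJ dJ dX dY cJ; rewrite /nijenhuis !(lie_covd Gam).
rewrite !covd_app // /app /proj02.
rewrite !mulmxBl !(mulmx_JJ _ JJ) !opprK.
set A := covd _ _ _ _; set B := covd _ _ _ _; set C := covd _ _ _ _ *m _.
set D := covd _ _ _ _ *m _; set E := eval12 _ _ _; set F := eval12 _ _ _.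
set G := eval12 _ _ _ *m _; set H := eval12 _ _ _ *m _.
by apply/rowP => k; rewrite !mxE; ring.
Qed.

End MatrixCalculus.

Section MatrixFields.
Variables (R : realType) (m : nat).
Implicit Types (U : set 'rV[R]_m) (f g : 'rV[R]_m -> R) (F G J : 'rV[R]_m -> 'M[R]_m)
  (u : 'rV[R]_m) (X Y : 'rV[R]_m -> 'rV[R]_m).

Definition smooth_mx U F := forall a b, smooth U (fun u => F u a b).

Lemma smooth_mx_mul U F G : open U -> smooth_mx U F -> smooth_mx U G ->
  smooth_mx U (fun u => F u *m G u).
Proof.
move=> Uo sF sG a b.
have := smooth_sum (index_enum 'I_m) xpredT Uo (fun k => smoothM Uo (sF a k) (sG k b)).
by apply: smooth_eq => // u _; rewrite mxE.
Qed.

Lemma smooth_mx_tr U F : open U -> smooth_mx U F -> smooth_mx U (fun u => (F u)^T).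
Proof. by move=> Uo sF a b; apply: (smooth_eq Uo _ (sF b a)) => u _; rewrite mxE. Qed.

Lemma smooth_mx_scale U f F : open U -> smooth U f -> smooth_mx U F ->
  smooth_mx U (fun u => f u *: F u).
Proof.
by move=> Uo sf sF a b; apply: (smooth_eq Uo _ (smoothM Uo sf (sF a b))) => u _; rewrite mxE.
Qed.

Lemma smooth_mxB U F G : open U -> smooth_mx U F -> smooth_mx U G ->
  smooth_mx U (fun u => F u - G u).
Proof.
move=> Uo sF sG a b; apply: (smooth_eq Uo _ (smoothB Uo (sF a b) (sG a b))) => u _.
by rewrite !mxE.
Qed.

Lemma smooth_mx_dmx U F a : open U -> smooth_mx U F -> smooth_mx U (dmx a F).
Proof.
move=> Uo sF b c; apply: (smooth_eq Uo _ (smooth_pd a (sF b c))) => u _.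
by rewrite mxE.
Qed.

Lemma dmx_eq U F G u a : open U -> U u -> (forall x, U x -> F x = G x) ->
  dmx a F u = dmx a G u.
Proof.
move=> Uo Uu FG; apply/matrixP => b c; rewrite !mxE; apply: (pd_eq a Uo Uu) => x /FG E.
by rewrite E.
Qed.

Definition derivable_mx_at F u := forall b c, derivable_at (fun x => F x b c) u.

Lemma smooth_derivable_mx U F u : smooth_mx U F -> U u -> derivable_mx_at F u.
Proof. by move=> sF Uu b c; exact: smooth_derivable_at (sF b c) Uu. Qed.

Lemma dmx_mul F G u a : derivable_mx_at F u -> derivable_mx_at G u ->
  dmx a (fun x => F x *m G x) u = dmx a F u *m G u + F u *m dmx a G u.
Proof.
move=> dF dG; apply/matrixP => b c; rewrite !mxE.
transitivity (pd a (fun x => \sum_j F x b j * G x j c) u).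
  by congr (pd _ _ _); apply/funext => x; rewrite mxE.
rewrite pd_sum => [|j]; last exact: derivable_atM.
by rewrite -big_split; apply: eq_bigr => j _ /=; rewrite pdM // !mxE.
Qed.

Lemma dmx_tr F u a : dmx a (fun x => (F x)^T) u = (dmx a F u)^T.
Proof.
by apply/matrixP => b c; rewrite !mxE; congr (pd _ _ _); apply/funext => x; rewrite mxE.
Qed.

Lemma derivable_mx_tr F u : derivable_mx_at F u -> derivable_mx_at (fun x => (F x)^T) u.
Proof.
move=> dF b c; have -> : (fun x => (F x)^T b c) = (fun x => F x c b); last exact: dF.
by apply/funext => x; rewrite mxE.
Qed.

(* [C a] is the covariant derivative of [W] in the direction [a]. *)
Lemma d_torsion (dW Gam : 'I_m -> 'M[R]_m) (W : 'M[R]_m) a b c : W^T = - W ->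
  let C a := dW a - Gam a *m W - W *m (Gam a)^T in
  dW a b c + dW b c a + dW c a b = (C a b c + C b c a + C c a b)
    + ((tors Gam a *m W) b c + (tors Gam b *m W) c a + (tors Gam c *m W) a b).
Proof.
move=> Ws C.
have CE x y z : C x y z = dW x y z - (Gam x *m W) y z + (Gam x *m W) z y.
  have E : (W *m (Gam x)^T) y z = - (Gam x *m W) z y.
    rewrite !mxE -sumrN; apply: eq_bigr => r _.
    by rewrite mxE (skew_entry y r Ws) mulNr mulrC.
  have sub3 (A B D : 'M[R]_m) : (A - B - D) y z = A y z - B y z - D y z by rewrite !mxE.
  by rewrite /C sub3 E opprK.
have TE x y z : (tors Gam x *m W) y z = (Gam x *m W) y z - (Gam y *m W) x z.
  by rewrite !mxE -sumrB; apply: eq_bigr => r _; rewrite mxE mulrBl.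
by rewrite !CE !TE; ring.
Qed.

End MatrixFields.

(* Otherwise failing unification problems unfold [pd] down to limits. *)
Local Opaque pd.

(** * Tensor fields on a manifold *)

Section Manifold.
Variables (R : realType) (m : nat) (M : manifold R m).
Implicit Types (V : set M) (i j : mindex M) (x : M) (u : 'rV[R]_m)
               (a b c : 'I_m).

Lemma codP V i u : cod V i u -> [/\ mdom i (mpar i u), V (mpar i u) & mchart i (mpar i u) = u].
Proof. by move=> [x [dx Vx] <-]; rewrite mchartK. Qed.

Lemma cod_chart V i x : mdom i x -> V x -> cod V i (mchart i x).
Proof. by move=> dx Vx; exists x. Qed.

Lemma cod_subset V V' i : V `<=` V' -> cod V i `<=` cod V' i.
Proof. by move=> VV' u [x [dx Vx] <-]; exists x => //; split => //; exact: VV'. Qed.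

Lemma cod_subT V i : cod V i `<=` cod setT i.
Proof. exact: cod_subset. Qed.

Lemma cod_open V i : open V -> open (cod V i).
Proof.
move=> Vo; rewrite openE => u Vu; have [du Vpu cu] := codP Vu.
have cdu : (mchart i @` mdom i) u by exists (mpar i u).
have n1 : \forall y \near u, (mchart i @` mdom i) y.
  by apply: open_nbhs_nbhs; split => //; exact: mcod_open.
have n2 : \forall y \near u, V (mpar i y).
  by apply: (mpar_continuous cdu); apply: open_nbhs_nbhs.
rewrite /interior /=; apply: filterS (filterI n1 n2) => y [[z dz <-]].
by rewrite mchartK // => Vz; exact: cod_chart.
Qed.

Lemma smooth_mxfield_subset V V' (F : mxfield M) : V `<=` V' ->
  smooth_mxfield V' F -> smooth_mxfield V F.
Proof. by move=> VV' sF i a b; apply: smooth_subset (sF i a b); exact: cod_subset. Qed.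

Lemma endo_field_subset V V' (F : mxfield M) : V `<=` V' -> endo_field V' F -> endo_field V F.
Proof.
move=> VV' [sF tF]; split; first exact: smooth_mxfield_subset sF.
by move=> i j x Vx; apply: tF; exact: VV'.
Qed.

Lemma bilin_field_subset V V' (F : mxfield M) : V `<=` V' -> bilin_field V' F -> bilin_field V F.
Proof.
move=> VV' [sF tF]; split; first exact: smooth_mxfield_subset sF.
by move=> i j x Vx; apply: tF; exact: VV'.
Qed.

Lemma bilin_field_mulJt V (J W : mxfield M) : open V -> endo_field V J -> bilin_field V W ->
  bilin_field V (fun i u => W i u *m (J i u)^T).
Proof.
move=> Vo [sJ tJ] [sW tW]; split.
  move=> i; apply: smooth_mx_mul; [exact: cod_open|exact: sW|].
  by apply: smooth_mx_tr; [exact: cod_open|exact: sJ].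
move=> i j x Vx dx dx'; rewrite (tW i j) // -!mulmxA -!trmx_mul (tJ i j) //.
Qed.

Lemma bilin_field_scale V (f : M -> R) (W : mxfield M) : open V ->
  (forall i, smooth (cod V i) (f \o mpar i)) -> bilin_field V W ->
  bilin_field V (fun i u => f (mpar i u) *: W i u).
Proof.
move=> Vo sf [sW tW]; split.
  by move=> i; apply: smooth_mx_scale; [exact: cod_open|exact: sf|exact: sW].
move=> i j x Vx dx dx'; rewrite (tW i j) // !mchartK //.
by rewrite -scalemxAr scalemxAl.
Qed.

Lemma bilin_fieldZ V (k : R) (W : mxfield M) : open V ->
  bilin_field V W -> bilin_field V (fun i u => k *: W i u).
Proof. by move=> Vo; apply: (@bilin_field_scale V (fun=> k)) => // i; exact: smooth_cst. Qed.

Lemma bilin_ratio V (F G : mxfield M) k i j x : bilin_field V F -> bilin_field V G ->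
  V x -> mdom i x -> mdom j x -> F i (mchart i x) = k *: G i (mchart i x) ->
  F j (mchart j x) = k *: G j (mchart j x).
Proof.
move=> [_ tF] [_ tG] Vx di dj E.
by rewrite (tF j i) // (tG j i) // E -scalemxAr -scalemxAl.
Qed.

(** Applied to the fundamental form, this makes the metric parallel, since [fundamentalK] recovers
    the metric from that form and [J]. *)
Lemma cov_bilin_mulJt (Gam : field12 M) (J W : mxfield M) i u a :
  derivable_mx_at (J i) u -> derivable_mx_at (W i) u ->
  cov_endo Gam J i u a = 0 -> cov_bilin Gam W i u a = 0 ->
  cov_bilin Gam (fun i u => W i u *m (J i u)^T) i u a = 0.
Proof.
move=> dJ dW cJ cW; rewrite /cov_bilin (dmx_mul a dW (derivable_mx_tr dJ)).
rewrite (dmx_tr (J i)).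
have -> : dmx a (J i) u = Gam i u a *m J i u - J i u *m Gam i u a.
  by apply/eqP; rewrite -subr_eq0 opprB addrA; apply/eqP.
have -> : dmx a (W i) u = Gam i u a *m W i u + W i u *m (Gam i u a)^T.
  by apply/eqP; rewrite -subr_eq0 opprD addrA; apply/eqP.
rewrite linearB /= !trmx_mul mulmxDl mulmxBr !mulmxA.
set A := Gam i u a *m _ *m _; set B := _ *m _ *m (J i u)^T; set C := _ *m _ *m (Gam i u a)^T.
by rewrite [C - B]addrC addrA addrK [A + C]addrC addrK subrr.
Qed.

Lemma transition_smooth V i j : open V -> V `<=` mdom j ->
  forall b, smooth (cod V i) (fun u => mchart j (mpar i u) 0 b).
Proof.
move=> Vo Vj b; apply: smooth_subset (@mtransition_smooth _ _ M i j b).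
by move=> u [x [dx Vx] <-]; exists x => //; split => //; exact: Vj.
Qed.

Lemma smooth_transition V i j (f : 'rV[R]_m -> R) : open V -> V `<=` mdom j ->
  smooth (cod V j) f -> smooth (cod V i) (fun u => f (mchart j (mpar i u))).
Proof.
move=> Vo Vj sf k; apply: (Ck_comp (cod_open (i := i) Vo) (cod_open (i := j) Vo) _ _ (sf k)).
  by move=> u /codP[dx Vx _]; exact: (cod_chart (Vj _ Vx) Vx).
by move=> b; exact: (@transition_smooth V i j Vo Vj b k).
Qed.

(* The second derivatives of the change of coordinates cancel in [d W], by
   Schwarz's theorem. *)
Lemma closed_form_chart V i0 (W : mxfield M) : open V -> V `<=` mdom i0 ->
  bilin_field V W ->
  (forall i u, cod V i u -> (W i u)^T = - W i u) ->
  (forall u, cod V i0 u -> forall a b c,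
    pd a (fun u' => W i0 u' b c) u + pd b (fun u' => W i0 u' c a) u
    + pd c (fun u' => W i0 u' a b) u = 0) ->
  closed_form V W.
Proof.
have cancel6 (x y z t w v : R) : x - y + z + (v - x + t) + (y - v + w) = z + t + w by ring.
move=> Vo Vi0 [sW tW] Wskew Wcl j u cu a b c.
have Uo : open (cod V j) by exact: cod_open.
have Uo0 : open (cod V i0) by exact: cod_open.
pose phi u' := mchart i0 (mpar j u').
have phiV u' : cod V j u' -> cod V i0 (phi u').
  by move=> /codP[dx Vx _]; exact: (cod_chart (Vi0 _ Vx) Vx).
have sphi b' : smooth (cod V j) (fun u => phi u 0 b') by exact: transition_smooth.
pose D b' r u' := pd b' (fun u => phi u 0 r) u'.
have sD b' r : smooth (cod V j) (D b' r) by exact: smooth_pd.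
have sWphi r s : smooth (cod V j) (fun u' => W i0 (phi u') r s).
  exact: (@smooth_transition V j i0 (fun u => W i0 u r s)).
have WE u' b' c' : cod V j u' ->
    W j u' b' c' = \sum_s (\sum_r D b' r u' * W i0 (phi u') r s) * D c' s u'.
  move=> cu'; have [dx Vx E] := codP cu'.
  have := tW j i0 _ Vx dx (Vi0 _ Vx); rewrite E => ->.
  rewrite mxE; apply: eq_bigr => s _; rewrite !mxE; congr (_ * _).
  by apply: eq_bigr => r _; rewrite !mxE.
have dD b' r : derivable_at (D b' r) u by exact: smooth_derivable_at (sD b' r) cu.
have dWphi r s : derivable_at (fun u' => W i0 (phi u') r s) u.
  exact: smooth_derivable_at (sWphi r s) cu.
pose P t r s := pd t (fun u' => W i0 u' r s) (phi u).
have pWphi a' r s : pd a' (fun u' => W i0 (phi u') r s) u = \sum_t D a' t u * P t r s.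
  have [|_ E] := @chain_rule R m _ phi 0 (cod V i0) (fun u => W i0 u r s) u (delta_mx 0 a')
    Uo0 (phiV _ cu) (sW i0 r s 1%N) _; last exact: E.
  by move=> b'; exact: (Ck_diff Uo cu (sphi b' 1%N)).1.
(* [X] carries the second derivatives of the coordinate change and [Z] the derivatives of [W] in the
   chart [i0]. The term in which the other Jacobian factor is differentiated is [- X a' c' b'], by
   skewness of [W]. *)
pose X a' b' c' := \sum_s \sum_r pd a' (D b' r) u * W i0 (phi u) r s * D c' s u.
pose Z a' b' c' := \sum_s \sum_r \sum_t D a' t u * D b' r u * D c' s u * P t r s.
have Ws r s : W i0 (phi u) r s = - W i0 (phi u) s r.
  exact/skew_entry/Wskew/phiV.
have pW a' b' c' : pd a' (fun u' => W j u' b' c') u = X a' b' c' - X a' c' b' + Z a' b' c'.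
  rewrite (pd_eq a' Uo cu (fun u' cu' => WE u' b' c' cu')).
  have dS s : derivable_at (fun u' => \sum_r D b' r u' * W i0 (phi u') r s) u.
    by apply: derivable_at_sum => r; exact: derivable_atM.
  rewrite pd_sum => [|s]; last exact: derivable_atM.
  have -> : X a' c' b' = - \sum_s \sum_r D b' r u * W i0 (phi u) r s * pd a' (D c' s) u.
    rewrite /X exchange_big /= -sumrN; apply: eq_bigr => s _.
    rewrite -sumrN; apply: eq_bigr => r _; rewrite (Ws s r); ring.
  rewrite opprK /X /Z -!big_split /=; apply: eq_bigr => s _.
  rewrite (pdM a' (dS s) (dD c' s)) pd_sum => [|r]; last exact: derivable_atM.
  rewrite !mulr_suml addrAC -!big_split /=; apply: eq_bigr => r _.
  rewrite (pdM a' (dD b' r) (dWphi r s)) pWphi mulrDl; congr (_ + _ + _).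
  rewrite mulr_sumr mulr_suml; apply: eq_bigr => t _; ring.
have Xsym a' b' c' : X a' b' c' = X b' a' c'.
  have Dsym r : pd a' (D b' r) u = pd b' (D a' r) u.
    exact: (pdC _ _ Uo cu (sphi r 2)).
  by apply: eq_bigr => s _; apply: eq_bigr => r _; rewrite Dsym.
(* Renaming summation indices gives all three sums the same Jacobian factors, multiplied by the
   cyclic permutations of [P t r s], which add up to zero. *)
have ZE : Z a b c + Z b c a + Z c a b = 0.
  have -> : Z b c a = \sum_s \sum_r \sum_t D a t u * D b r u * D c s u * P r s t.
    rewrite /Z exchange_big /=; apply: eq_bigr => s _.
    rewrite exchange_big /=; apply: eq_bigr => r _; apply: eq_bigr => t _.
    by congr (_ * _); rewrite mulrC mulrA.
  have -> : Z c a b = \sum_s \sum_r \sum_t D a t u * D b r u * D c s u * P s t r.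
    rewrite /Z; under eq_bigr do rewrite exchange_big /=.
    rewrite exchange_big /=; apply: eq_bigr => s _.
    apply: eq_bigr => r _; apply: eq_bigr => t _.
    by congr (_ * _); rewrite -mulrA mulrC.
  rewrite /Z -!big_split big1 // => s _; rewrite -!big_split big1 // => r _.
  rewrite -!big_split big1 // => t _ /=; rewrite -!mulrDr.
  by rewrite /P (Wcl _ (phiV _ cu)) mulr0.
rewrite !pW (Xsym b a c) (Xsym c b a) (Xsym c a b) -[RHS]ZE; exact: cancel6.
Qed.

End Manifold.

(** * Closedness of the form [theta] *)

Section ThetaClosed.
Variables (R : realType) (m : nat).
Implicit Types (U : set 'rV[R]_m) (f g : 'rV[R]_m -> R) (u : 'rV[R]_m).
Lemma open_neq0 U f : open U -> smooth U f -> open (U `&` [set u | f u != 0]).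
Proof.
move=> Uo sf; rewrite openE => u [Uu fu]; rewrite /interior /=.
apply: filterI; first exact: open_nbhs_nbhs.
exact: (cvgr_neq0 _ (smooth_continuous sf Uu) fu).
Qed.

Lemma dtheta_eq0 U (W : 'rV[R]_m -> 'M[R]_m) (theta : 'I_m -> 'rV[R]_m -> R) :
  (4 < m)%N -> open U -> smooth_mx U W -> (forall a, smooth U (theta a)) ->
  (forall u, U u -> W u \in unitmx /\ (W u)^T = - W u) ->
  (forall u, U u -> forall a b c,
    pd a (fun u' => W u' b c) u + pd b (fun u' => W u' c a) u
    + pd c (fun u' => W u' a b) u
    = theta a u * W u b c + theta b u * W u c a + theta c u * W u a b) ->
  forall u a b, U u -> pd a (theta b) u = pd b (theta a) u.
Proof.
move=> m4 Uo sW sth WH E u a b Uu; have [Wu Ws] := WH u Uu.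
apply/eqP; rewrite -subr_eq0; apply/eqP.
apply: (two_form_wedge0 (F := fun x y => pd x (theta y) u - pd y (theta x) u) m4 Wu Ws).
  by move=> x y; rewrite opprB.
have skew_pd t b' c' v : U v -> pd t (fun u' => W u' b' c') v = - pd t (fun u' => W u' c' b') v.
  move=> Uv; rewrite -pdN; last exact: smooth_derivable_at (sW c' b') Uv.
  by apply: (pd_eq t Uo Uv) => y Uy; apply: skew_entry; have [] := WH y Uy.
move=> {}a {}b c d.
apply: (@dtheta_wedge_eq0 R m (fun d a b c => pd d (pd a (fun u' => W u' b c)) u)
  (fun a b c => pd a (fun u' => W u' b c) u) (fun d a => pd d (theta a) u) (fun b c => W u b c)
  (fun a => theta a u)).
- by move=> *; exact: (pdC _ _ Uo Uu (sW _ _ 2)).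
- move=> x y z w; rewrite -pdN; last exact: smooth_derivable_at (smooth_pd y (sW w z)) Uu.
  by apply: (pd_eq x Uo Uu) => v Uv; exact: skew_pd.
- by move=> *; exact: skew_pd.
- by move=> *; exact: skew_entry.
- exact: E.
move=> x y z w.
have dW2 t b' c' : derivable_at (pd t (fun u' => W u' b' c')) u.
  exact: smooth_derivable_at (smooth_pd t (sW b' c')) Uu.
have dW b' c' : derivable_at (fun u' => W u' b' c') u by exact: smooth_derivable_at (sW b' c') Uu.
have dth t : derivable_at (theta t) u by exact: smooth_derivable_at (sth t) Uu.
have := pd_eq x Uo Uu (fun v Uv => E v Uv y z w).
rewrite (pdD x (derivable_atD (dW2 _ _ _) (dW2 _ _ _)) (dW2 _ _ _)).
rewrite (pdD x (dW2 _ _ _) (dW2 _ _ _)) => ->.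
have dM t b' c' := derivable_atM (dth t) (dW b' c').
rewrite (pdD x (derivable_atD (dM _ _ _) (dM _ _ _)) (dM _ _ _)) (pdD x (dM _ _ _) (dM _ _ _)).
by rewrite !(pdM x (dth _) (dW _ _)).
Qed.

End ThetaClosed.

(** * Linearity of the projection to type (0,2) *)

Section TorsionTypes.
Variables (R : realType) (m : nat).
Implicit Types (J W : 'M[R]_m) (T : 'I_m -> 'M[R]_m) (v w z : 'rV[R]_m).

Lemma eval12_tors (Gam : 'I_m -> 'M[R]_m) v w :
  eval12 (tors Gam) v w = - eval12 (tors Gam) w v.
Proof.
rewrite !eval12_sum exchange_big /= -sumrN; apply: eq_bigr => a _.
rewrite -sumrN; apply: eq_bigr => b _; apply/rowP => c; rewrite !mxE; ring.
Qed.

Lemma type02Z J T k : type02 J T -> type02 J (fun a => k *: T a).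
Proof.
move=> H v w; have [h1 h2 h3] := H v w; rewrite !eval12Z.
by split; [rewrite h1 scalerN|rewrite h2 scalerN scalemxAl|rewrite h3 scalerN scalemxAl].
Qed.

Lemma lambda30_lin W T T' k : lambda30 W T -> lambda30 W T' ->
  lambda30 W (fun a => T a + k *: T' a).
Proof.
move=> [T1 T2 T3] [S1 S2 S3].
have E a b c : ((T a + k *: T' a) *m W) b c = (T a *m W) b c + k * (T' a *m W) b c.
  by rewrite mulmxDl -scalemxAl mxE [X in _ + X]mxE.
split=> [a b c|a b c|c]; rewrite ?E.
- by rewrite T1 S1 mulrN opprD.
- by rewrite T2 S2 mulrN opprD.
transitivity (\sum_a \sum_b invmx W a b * (T a *m W) b c
   + k * \sum_a \sum_b invmx W a b * (T' a *m W) b c).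
  rewrite mulr_sumr -big_split; apply: eq_bigr => a _ /=.
  rewrite mulr_sumr -big_split; apply: eq_bigr => b _ /=; rewrite E mulrDr; congr (_ + _).
  by rewrite mulrCA.
by rewrite T3 S3 mulr0 addr0.
Qed.

Lemma mx02_lin J T T' k a :
  mx02 J (fun a => T a + k *: T' a) a = mx02 J T a + k *: mx02 J T' a.
Proof.
move: a; apply: eval12_inj => v w.
by rewrite eval12D eval12Z !eval12_mx02 (proj02D J T) proj02Z.
Qed.

Lemma mx02_of_type02 J T a : J *m J = - 1%:M -> type02 J T -> mx02 J T a = 4 *: T a.
Proof.
move=> JJ T02; move: a; apply: eval12_inj => v w.
by rewrite eval12_mx02 eval12Z proj02_type02.
Qed.

Lemma mx02_type02_tors J Gam : J *m J = - 1%:M -> type02 J (mx02 J (tors Gam)).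
Proof. by move=> JJ; apply: mx02_type02 => // v w; exact: eval12_tors. Qed.

End TorsionTypes.

(** * The canonical connection *)

Section EllFibre.
Variables (R : realType) (p q : nat) (M : manifold R (p + q).*2) (S : pacs M).
Local Notation m := ((p + q).*2).
Local Notation J := (cstr S).
Implicit Types (V : set M) (i j : mindex M) (x : M) (u : 'rV[R]_m) (W G : 'M[R]_m).

Lemma cstr_sq i u : cod setT i u -> J i u *m J i u = - 1%:M.
Proof. exact: (cstr_almost_complex S).2. Qed.

Lemma cstr_smooth i : smooth_mx (cod setT i) (J i).
Proof. by have [[sJ _] _] := cstr_almost_complex S; exact: sJ. Qed.

Lemma cstr_endo : endo_field setT J.
Proof. by have [] := cstr_almost_complex S. Qed.

Lemma cstr_derivable i u : cod setT i u -> derivable_mx_at (J i) u.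
Proof. exact/smooth_derivable_mx/cstr_smooth. Qed.

Lemma signature_unit r (G : 'M[R]_m) : has_signature r G -> G \in unitmx.
Proof.
move=> [P Pu E]; have : P *m G *m P^T \in unitmx.
  rewrite E unitmxE det_diag unitfE; apply/prodf_neq0 => k _; rewrite mxE.
  by case: ifP => _; rewrite ?oppr_eq0 oner_eq0.
by rewrite !unitmx_mul => /andP[/andP[]].
Qed.

Lemma fundamental_props (j G : 'M[R]_m) : j *m j = - 1%:M -> G^T = G ->
  j *m G *m j^T = G -> G \in unitmx ->
  [/\ fundamental j G \in unitmx, (fundamental j G)^T = - fundamental j G
    & j *m fundamental j G *m j^T = fundamental j G].
Proof.
move=> jj Gs jG Gu.
have ju : j \in unitmx by apply: (@mulmx1_unit _ _ j (- j) _).1; rewrite mulmxN jj opprK.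
have jtjt : j^T *m j^T = - 1%:M by rewrite -trmx_mul jj linearN /= trmx1.
have jGE : j *m G = - (G *m j^T) by rewrite -[in RHS]jG -mulmxA jtjt mulmxN mulmx1 opprK.
rewrite /fundamental; split.
- by rewrite -scaleN1r unitmxZ ?unitrN1 // unitmx_mul Gu unitmx_tr.
- by rewrite linearN /= trmx_mul trmxK Gs jGE.
- by rewrite mulmxN mulNmx mulmxA -mulmxA; congr (- _); rewrite jtjt mulmxN mulmx1 jGE opprK.
Qed.

Lemma fundamentalZ (j G : 'M[R]_m) k : fundamental j (k *: G) = k *: fundamental j G.
Proof. by rewrite /fundamental -scalemxAl scalerN. Qed.

Lemma fundamentalK (j G : 'M[R]_m) : j *m j = - 1%:M -> fundamental j G *m j^T = G.
Proof.
move=> jj; rewrite /fundamental mulNmx -mulmxA -trmx_mul jj linearN /= trmx1.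
by rewrite mulmxN mulmx1 opprK.
Qed.

Lemma hermitian_fundamental V g i u : almost_hermitian V J g -> cod V i u ->
  [/\ fundamental (J i u) (g i u) \in unitmx,
      (fundamental (J i u) (g i u))^T = - fundamental (J i u) (g i u)
    & J i u *m fundamental (J i u) (g i u) *m (J i u)^T = fundamental (J i u) (g i u)].
Proof.
move=> [_ gH] cu; have [gs gJ gsig] := gH i u cu.
exact: fundamental_props (cstr_sq (cod_subT cu)) gs gJ (signature_unit gsig).
Qed.

(** The factor in [conf] and the factor in [ell] merge into one, so that near [x] the fibre of [ell]
    is the full real line, zero included, through the fundamental form of a single metric. *)
Lemma conf_localE x : exists V g, [/\ open V, V x, in_class S V g
  & forall i u, cod V i u -> forall W,
      ell S i u W <-> exists c, W = c *: fundamental (J i u) (g i u)].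
Proof.
have [V [g [Vo Vx gH gC]]] := conf_local S x.
exists V, g; split=> // [|i u cu W].
  by split=> // i u cu; rewrite (gC i u cu); exists 1; rewrite ?oner_eq0 ?scale1r.
split=> [[c [G]]|[c ->]].
  rewrite (gC i u cu) => -[k _ ->] ->; exists (c * k).
  by rewrite fundamentalZ scalerA.
exists c, (g i u) => //; rewrite (gC i u cu); exists 1; rewrite ?oner_eq0 ?scale1r //.
Qed.

Lemma ell_frame i u : cod setT i u -> exists W0 : 'M[R]_m,
  [/\ W0 \in unitmx, W0^T = - W0, J i u *m W0 *m (J i u)^T = W0
    & forall W, ell S i u W <-> exists c, W = c *: W0].
Proof.
move=> cu; have [du _ E] := codP cu.
have [V [g [Vo Vx [gH _] ellP]]] := conf_localE (mpar i u).
have cVu : cod V i u by rewrite -E; exact: cod_chart.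
have [h1 h2 h3] := hermitian_fundamental gH cVu.
by exists (fundamental (J i u) (g i u)); split=> // W; exact: ellP.
Qed.

Lemma ell_nondeg i u W : cod setT i u -> ell S i u W -> W != 0 ->
  [/\ W \in unitmx, W^T = - W & J i u *m W *m (J i u)^T = W].
Proof.
move=> cu + Wn0; have [W0 [h1 h2 h3 hE]] := ell_frame cu.
move=> /hE[c WE]; rewrite WE; have c0 : c != 0.
  by apply: contraNneq Wn0 => c0; rewrite WE c0 scale0r.
by split; [rewrite unitmxZ // unitfE|rewrite linearZ /= h2 scalerN|
  rewrite -scalemxAr -scalemxAl h3].
Qed.

Lemma ell_skew i u W : cod setT i u -> ell S i u W -> W^T = - W.
Proof.
move=> cu; have [W0 [h1 h2 h3 hE]] := ell_frame cu.
by move=> /hE[c ->]; rewrite linearZ /= h2 scalerN.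
Qed.

Lemma ell_ratio i u W W' : cod setT i u -> ell S i u W -> W != 0 -> ell S i u W' ->
  exists c, W' = c *: W.
Proof.
move=> cu + Wn0; have [W0 [h1 h2 h3 hE]] := ell_frame cu.
move=> /hE[c WE] /hE[c' ->]; rewrite WE in Wn0 *; have c0 : c != 0.
  by apply: contraNneq Wn0 => c0; rewrite c0 scale0r.
by exists (c' / c); rewrite scalerA divfK.
Qed.

Lemma ellZ i u W k : ell S i u W -> ell S i u (k *: W).
Proof. by move=> [c [G GC ->]]; exists (k * c), G; rewrite ?scalerA. Qed.

Lemma unit_neq0 W : (0 < m)%N -> W \in unitmx -> W != 0.
Proof.
move=> m0 Wu; apply/eqP => W0; move: Wu m0; rewrite W0.
case: m => // k; by rewrite unitmxE det0 unitr0.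
Qed.

Lemma fundamental_section V g : open V -> in_class S V g ->
  section_ell S V (fun i u => fundamental (J i u) (g i u)).
Proof.
move=> Vo [[gB gH] gC]; split.
  have := bilin_fieldZ (-1) Vo (bilin_field_mulJt Vo
    (endo_field_subset (@subsetT _ V) cstr_endo) gB).
  congr bilin_field; apply/funext => i; apply/funext => u.
  by rewrite scaleN1r.
move=> i u cu; exists 1, (g i u); rewrite ?scale1r //; exact: gC.
Qed.

End EllFibre.

(** * Harmonic torsion, vanishing of the torsion, integrability *)

Section Canonical.
Variables (R : realType) (p q : nat) (M : manifold R (p + q).*2) (S : pacs M).
Variable nabla : field12 M.
Local Notation m := ((p + q).*2).
Local Notation J := (cstr S).
Implicit Types (V : set M) (i j : mindex M) (x : M) (u : 'rV[R]_m) (W G : 'M[R]_m).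
Hypothesis pq2 : (2 <= p + q)%N.
Hypothesis nablaC : canonical_connection S nabla.

Let m_gt2 : (2 < m)%N. 
Proof. by have := pq2; rewrite -leq_double; apply: leq_trans. Qed.

Let m_gt0 : (0 < m)%N. Proof. exact: leq_trans m_gt2. Qed.

Lemma torsion_proj02 i (X Y : 'rV[R]_m -> 'rV[R]_m) u : cod setT i u ->
  (forall b, derivable_at (fun y => X y 0 b) u) ->
  (forall b, derivable_at (fun y => Y y 0 b) u) ->
  nijenhuis (J i) X Y u = - proj02 (J i u) (torsion nabla i u) (X u) (Y u).
Proof.
move=> cu dX dY; have [_ [cJ _] _] := nablaC.
apply: (@nijenhuis_torsion R m (nabla i u)) => //; first exact: (cstr_sq S cu).
  exact: (cstr_derivable (S := S) cu).
by move=> a; exact: cJ.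
Qed.

Lemma nijenhuis_mx02 i u a : cod setT i u ->
  nijenhuis_tensor J i u a = - mx02 (J i u) (torsion nabla i u) a.
Proof.
move=> cu; apply/matrixP => b c; rewrite mxE torsion_proj02 //; last 2 first.
- by move=> k; exact: derivable_at_cst.
- by move=> k; exact: derivable_at_cst.
by rewrite -eval12_mx02 eval12_delta !mxE.
Qed.

Lemma harmonic_torsionP (Th : field12 M) : harmonic_torsion S nabla Th <->
  forall i u, cod setT i u -> forall a, Th i u a = (- 4^-1) *: nijenhuis_tensor J i u a.
Proof.
have c4 : (4 : R) != 0 by rewrite pnatr_eq0.
split=> [H i u cu a|H i u cu].
  have JJ := cstr_sq S cu; have [Th02 _ Ta0] := H i u cu.
  rewrite nijenhuis_mx02 // scaleNr scalerN opprK.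
  apply: (scalerI c4); rewrite scalerA mulfV // scale1r; move: a; apply: eval12_inj => v w.
  rewrite eval12Z -(proj02_type02 v w JJ Th02) eval12_mx02.
  have TE : torsion nabla i u = (fun a => (torsion nabla i u a - Th i u a) + Th i u a).
    by apply/funext => a; rewrite subrK.
  by rewrite [in RHS]TE proj02D Ta0 add0r.
have JJ := cstr_sq S cu; have [_ _ /(_ i u cu)[Th0 [Ta0 [Th02 TaL TE]]]] := nablaC.
have {}H a : Th i u a = 4^-1 *: mx02 (J i u) (torsion nabla i u) a.
  by rewrite H // nijenhuis_mx02 // scaleNr scalerN opprK.
have HT : Th i u = (fun a => 4^-1 *: mx02 (J i u) (torsion nabla i u) a) by apply/funext.
have P02 : type02 (J i u) (Th i u) by rewrite HT; exact/type02Z/mx02_type02_tors.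
split=> // [W eW W0|v w].
  have [Wu Ws WJ] := ell_nondeg cu eW W0.
  have LT := TaL W eW W0.
  (* The remainder [torsion - Th] equals [Ta0 - mx02 Ta0 / 4]: the summand [Th0] drops out, being
     its own (0,2)-part. *)
  have := lambda30_lin (- 4^-1) LT (lambda30_mx02 JJ WJ Wu Ws LT).
  congr (lambda30 W); apply/funext => a; rewrite H TE.
  have -> : torsion nabla i u = (fun a => Ta0 a + 1 *: Th0 a).
    by apply/funext => b; rewrite TE scale1r addrC.
  rewrite mx02_lin scale1r (mx02_of_type02 _ JJ Th02).
  set B := mx02 _ _ _; have -> : 4^-1 *: (B + 4 *: Th0 a) = 4^-1 *: B + Th0 a.
    by rewrite scalerDr scalerA mulVf // scale1r.
  by rewrite scaleNr opprD addrA [RHS]addrC -addrA [RHS]addKr.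
have -> : (fun a => torsion nabla i u a - Th i u a)
    = (fun a => torsion nabla i u a + (-1) *: Th i u a).
  by apply/funext => a; rewrite scaleN1r.
rewrite proj02D proj02Z (proj02_type02 v w JJ P02) HT eval12Z (scalerA 4) mulfV //.
by rewrite scale1r eval12_mx02 scaleN1r subrr.
Qed.

(** Without a (0,2)-part the harmonic torsion is zero at the point, so the complementary component
    is all of the torsion. *)
Lemma torsion_lambda30 i u W : cod setT i u -> ell S i u W -> W != 0 ->
  (forall v w, proj02 (J i u) (torsion nabla i u) v w = 0) ->
  lambda30 W (torsion nabla i u).
Proof.
move=> cu eW W0 N0.
have zero : harmonic_torsion S nabla (fun i u a => (- 4^-1) *: nijenhuis_tensor J i u a).
  by apply/harmonic_torsionP.
have [_ /(_ W eW W0) L _] := zero i u cu; move: L; congr (lambda30 W).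
apply/funext => a; rewrite nijenhuis_mx02 //.
have -> : mx02 (J i u) (torsion nabla i u) a = 0.
  transitivity ((0 : 'I_m -> 'M[R]_m) a) => //; move: a; apply: eval12_inj => v w.
  by rewrite eval12_mx02 N0 /eval12 big1 // => a _; rewrite mulmx0 scaler0.
by rewrite oppr0 scaler0 subr0.
Qed.

(** Compatibility keeps the covariant derivative in [ell], a line spanned by [W] where [W] is
    non-zero. The coefficients are chosen at one point, so nothing is said yet about smoothness in
    [u]. *)
Lemma cov_ell V (W : mxfield M) i u : open V -> section_ell S V W -> cod V i u ->
  W i u != 0 -> exists theta : 'I_m -> R, forall a, cov_bilin nabla W i u a = theta a *: W i u.
Proof.
move=> Vo sW cu W0; have [_ [_ cE] _] := nablaC.
have H a : exists k, cov_bilin nabla W i u a = k *: W i u.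
  by apply: (ell_ratio (cod_subT cu) _ W0); [exact: sW.2|exact: cE sW _ _ cu a].
by exists (fun a => sval (cid (H a))) => a; case: cid.
Qed.

Lemma d_section V (W : mxfield M) i u a b c : open V -> section_ell S V W -> cod V i u ->
  pd a (fun u' => W i u' b c) u + pd b (fun u' => W i u' c a) u
    + pd c (fun u' => W i u' a b) u =
  cov_bilin nabla W i u a b c + cov_bilin nabla W i u b c a + cov_bilin nabla W i u c a b
  + ((torsion nabla i u a *m W i u) b c + (torsion nabla i u b *m W i u) c a
     + (torsion nabla i u c *m W i u) a b).
Proof.
move=> Vo [_ eW] cu.
have := d_torsion (fun a => dmx a (W i) u) (nabla i u) a b c
  (ell_skew (cod_subT cu) (eW i u cu)).
by rewrite /= !(mxE _ (fun b c => pd _ _ _)).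
Qed.

Lemma torsion_vanish V (W : mxfield M) i u : open V -> section_ell S V W -> cod V i u ->
  W i u != 0 ->
  (forall a b c, pd a (fun u' => W i u' b c) u + pd b (fun u' => W i u' c a) u
    + pd c (fun u' => W i u' a b) u = 0) ->
  (forall v w, proj02 (J i u) (torsion nabla i u) v w = 0) ->
  (forall a, torsion nabla i u a = 0) /\ forall a, cov_bilin nabla W i u a = 0.
Proof.
move=> Vo sW cu W0 dW N0; have cuT := cod_subT cu; have eW := sW.2 i u cu.
have [theta thE] := cov_ell Vo sW cu W0.
have [Wu Ws _] := ell_nondeg cuT eW W0.
have L := torsion_lambda30 cuT eW W0 N0.
have [|th0 T0] := @theta_wedge_torsion _ _ _ _ theta m_gt2 Wu Ws L.
  by move=> a b c; rewrite -[RHS](dW a b c) (d_section a b c Vo sW cu) !thE !mxE.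
by split=> // a; rewrite thE th0 scale0r.
Qed.

(** The (0,1)-fields [v + i J v] with constant [v] suffice: that their bracket is again of type
    (0,1) amounts to the vanishing of the Nijenhuis tensor on [v] and [w]. *)
Lemma integrable_proj02 V i u : open V -> integrable_acs V J -> cod V i u ->
  forall v w, proj02 (J i u) (torsion nabla i u) v w = 0.
Proof.
move=> Vo iJ cu v w; have cuT := cod_subT cu; have JJ := cstr_sq S cuT.
have Uo : open (cod V i) by exact: cod_open.
pose Z (v : 'rV[R]_m) := (fun _ : 'rV[R]_m => v, app (J i) (fun=> v)).
have sZ1 (z : 'rV[R]_m) : smooth_vf (cod V i) (Z z).1 by move=> a; exact: smooth_cst.
have sZ2 (z : 'rV[R]_m) : smooth_vf (cod V i) (Z z).2.
  move=> a; have := smooth_sum (index_enum 'I_m) xpredT Uo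
    (fun k => smoothM Uo (smooth_cst (cod V i) (z 0 k))
      (smooth_subset (@cod_subT _ _ M V i) (cstr_smooth S i k a))).
  by apply: smooth_eq => // y _; rewrite /= /app mxE.
have tZ z : type01 (J i) (cod V i) (Z z).
  by move=> y cy; split=> //=; rewrite /app mulmx_JJ //; exact: (cstr_sq S (cod_subT cy)).
have [E _] := iJ i _ Uo (@subset_refl _ _) _ _ (sZ1 v) (sZ2 v) (sZ1 w) (sZ2 w) (tZ v) (tZ w) u cu.
have := @torsion_proj02 i (fun=> v) (fun=> w) u cuT.
move=> /(_ (fun b => @derivable_at_cst _ _ _ u) (fun b => @derivable_at_cst _ _ _ u)) N.
apply: oppr_inj; rewrite oppr0 -N /nijenhuis -addrA -mulmxDl.
move: E; rewrite /app /= => E; rewrite [X in _ + X *m _]addrC -E mulmx_JJ // subrr.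
by [].
Qed.

Lemma lie_eq U (X X' Y Y' : 'rV[R]_m -> 'rV[R]_m) u : open U -> U u ->
  (forall y, U y -> X y = X' y) -> (forall y, U y -> Y y = Y' y) ->
  lie X Y u = lie X' Y' u.
Proof.
move=> Uo Uu XE YE; apply/rowP => b; rewrite !mxE; apply: eq_bigr => a _.
rewrite XE // YE //; congr (_ * _ - _ * _); apply: (pd_eq a Uo Uu) => y Uy.
  by rewrite YE.
by rewrite XE.
Qed.

Lemma proj02_integrable V : 
  (forall i u, cod V i u -> forall v w, proj02 (J i u) (torsion nabla i u) v w = 0) ->
  integrable_acs V J.
Proof.
move=> H i U Uo UV Z W sZ1 sZ2 sW1 sW2 tZ tW u Uu.
have cu := UV u Uu; have cuT := cod_subT cu; have JJ := cstr_sq S cuT.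
have ZE y : U y -> Z.2 y = app (J i) Z.1 y by move=> /tZ[].
have WE y : U y -> W.2 y = app (J i) W.1 y by move=> /tW[].
have dd X : smooth_vf U X -> forall b, derivable_at (fun y => X y 0 b) u.
  by move=> sX b; exact: smooth_derivable_at (sX b) Uu.
have := torsion_proj02 cuT (dd _ sZ1) (dd _ sW1); rewrite H // oppr0 /nijenhuis.
rewrite -addrA -mulmxDl => /eqP; rewrite addr_eq0 => /eqP N.
have A : (clie Z W).1 u = lie Z.1 W.1 u - lie (app (J i) Z.1) (app (J i) W.1) u.
  by rewrite /= (lie_eq Uo Uu ZE WE).
have B : (clie Z W).2 u = lie (app (J i) Z.1) W.1 u + lie Z.1 (app (J i) W.1) u.
  have h1 : lie Z.1 W.2 u = lie Z.1 (app (J i) W.1) u.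
    exact: (lie_eq Uo Uu (fun _ _ => erefl) WE).
  have h2 : lie Z.2 W.1 u = lie (app (J i) Z.1) W.1 u.
    exact: (lie_eq Uo Uu ZE (fun _ _ => erefl)).
  by rewrite -h1 -h2 [RHS]addrC.
by split; rewrite {1}/app A B N ?opprK // mulNmx mulmx_JJ // opprK.
Qed.

End Canonical.

(** * From vanishing torsion to the PCS condition *)

Section ThetaWedge.
Variables (R : realType) (m : nat).

Lemma mx_neq0 (A : 'M[R]_m) : A != 0 -> exists a b, A a b != 0.
Proof.
move=> A0; have [|H] := pselect (exists a b, A a b != 0); first by [].
case/eqP: A0; apply/matrixP => a b; rewrite mxE; apply/eqP/negP => /negP ab.
by apply: H; exists a, b.
Qed.

(** Injectivity of wedging one-forms with [W], used for the differential of the ratio of two Kaehler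
    metrics. *)
Lemma theta_wedge0 (W : 'M[R]_m) (theta : 'I_m -> R) : (2 < m)%N ->
  W \in unitmx -> W^T = - W ->
  (forall a b c, theta a * W b c + theta b * W c a + theta c * W a b = 0) ->
  forall a, theta a = 0.
Proof.
move=> m2 Wu Ws H c; have := theta_wedge_trace theta c Wu Ws.
rewrite big1 => [/esym/eqP|a _]; last by rewrite big1 // => b _; rewrite H mulr0.
rewrite mulf_eq0 => /orP[|/eqP //]; rewrite subr_eq0 eqr_nat => /eqP m2E.
by rewrite -m2E in m2.
Qed.

End ThetaWedge.

Section TorsionFreePcs.
Variables (R : realType) (p q : nat) (M : manifold R (p + q).*2) (S : pacs M).
Variable nabla : field12 M.
Local Notation m := ((p + q).*2).
Local Notation J := (cstr S).
Implicit Types (V : set M) (i j : mindex M) (x : M) (u : 'rV[R]_m) (W G : 'M[R]_m).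
Hypothesis nablaC : canonical_connection S nabla.

Lemma smooth_cov_bilin V (W : mxfield M) i a : open V -> smooth_mxfield V W ->
  smooth_mx (cod V i) (fun u => cov_bilin nabla W i u a).
Proof.
move=> Vo sW; have Uo : open (cod V i) by exact: cod_open.
have [[sG _] _ _] := nablaC.
have sGam : smooth_mx (cod V i) (fun u => nabla i u a).
  by move=> b c; apply: smooth_subset (sG i a b c); exact: cod_subT.
apply: smooth_mxB => //; first apply: smooth_mxB => //.
- exact: smooth_mx_dmx (sW i).
- exact: smooth_mx_mul.
- by apply: smooth_mx_mul => //; exact: smooth_mx_tr.
Qed.

Lemma chart_preimage_open V i (B : set 'rV[R]_m) : open V -> open B ->
  open [set x | [/\ V x, mdom i x & B (mchart i x)]].
Proof.
move=> Vo Bo; rewrite openE => x [Vx dx Bx]; rewrite /interior /=.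
have n1 : nbhs x V by exact: open_nbhs_nbhs.
have n2 : nbhs x (mdom i) by apply: open_nbhs_nbhs; split => //; exact: mdom_open.
have n3 : nbhs x (fun y => B (mchart i y)).
  by apply: (mchart_continuous dx); exact: open_nbhs_nbhs.
by apply: filterS (filterI n1 (filterI n2 n3)) => y [? [? ?]].
Qed.

Lemma torsion_free_pcs : (3 <= p + q)%N -> torsion_free setT nabla -> pcs S.
Proof.
move=> pq3 T0 x.
have m4 : (4 < m)%N by have := pq3; rewrite -leq_double; apply: leq_trans.
have m0 : (0 < m)%N by exact: leq_trans m4.
have [V0 [g0 [V0o V0x g0C ellP]]] := conf_localE S x.
have [i0 dx] := mdom_cover x.
pose W0 : mxfield M := fun i u => fundamental (J i u) (g0 i u).
have sW0 : section_ell S V0 W0 by exact: fundamental_section.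
have W0p i u : cod V0 i u -> W0 i u \in unitmx /\ (W0 i u)^T = - W0 i u.
  by move=> cu; have [] := hermitian_fundamental g0C.1 cu.
pose u0 := mchart i0 x; have cu0 : cod V0 i0 u0 by exact: cod_chart.
(* Dividing by an entry of [W0] that is non-zero at [u0] exhibits [theta] as a smooth function near
   [u0]. *)
have [b0 [c0 W00]] := mx_neq0 (unit_neq0 m0 (W0p _ _ cu0).1).
have Co : open (cod V0 i0) by exact: cod_open.
pose U := cod V0 i0 `&` [set u | W0 i0 u b0 c0 != 0].
have Uo : open U by apply: open_neq0 => //; exact: sW0.1.1.
have UV : U `<=` cod V0 i0 by move=> u [].
pose theta a u := cov_bilin nabla W0 i0 u a b0 c0 / W0 i0 u b0 c0.
have sW0U : smooth_mx U (W0 i0) by move=> b c; apply: smooth_subset (sW0.1.1 i0 b c).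
have sth a : smooth U (theta a).
  apply: smoothM => //; last by apply: smoothV => // u [].
  by apply: smooth_subset UV _; exact: smooth_cov_bilin V0o sW0.1.1 b0 c0.
have thE u a : U u -> cov_bilin nabla W0 i0 u a = theta a u *: W0 i0 u.
  move=> [cu Wu]; have [k kE] := cov_ell nablaC V0o sW0 cu (unit_neq0 m0 (W0p _ _ cu).1).
  by rewrite kE /theta kE mxE mulfK.
have E u : U u -> forall a b c,
    pd a (fun u' => W0 i0 u' b c) u + pd b (fun u' => W0 i0 u' c a) u
    + pd c (fun u' => W0 i0 u' a b) u
    = theta a u * W0 i0 u b c + theta b u * W0 i0 u c a + theta c u * W0 i0 u a b.
  move=> Uu a b c; have cu := UV _ Uu.
  rewrite (d_section nabla a b c V0o sW0 cu) !(T0 i0 u (cod_subT cu)).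
  by rewrite !mul0mx !(thE u) // !mxE !addr0.
have thC := dtheta_eq0 m4 Uo sW0U sth (fun u Uu => W0p _ _ (UV u Uu)) E.
have [r /= r0 rU] : exists2 r : R, 0 < r & ball u0 r `<=` U.
  by apply/nbhs_ballP; apply: open_nbhs_nbhs.
have [f sf fE] := @smooth_primitive R m u0 r theta
  (fun a => smooth_subset rU (sth a)) (fun y a b By => thC y a b (rU y By)).
pose B := ball u0 r; have Bo : open B by exact: (ball_open u0 r).
pose V := [set y | [/\ V0 y, mdom i0 y & B (mchart i0 y)]].
have Vo : open V by exact: chart_preimage_open.
have VV0 : V `<=` V0 by move=> y [].
have Vi0 : V `<=` mdom i0 by move=> y [].
have VB : cod V i0 `<=` B by move=> u [y [_ [_ _ By]] <-].
pose h u := expR (- f u).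
have sh : smooth B h by apply: smooth_expR => //; exact: smoothN.
pose W : mxfield M := fun i u => h (mchart i0 (mpar i u)) *: W0 i u.
have WB : bilin_field V W.
  apply: (@bilin_field_scale R m M V (h \o mchart i0)) => //.
    move=> i; apply: (@smooth_transition R m M V i i0 h) => //.
    exact: smooth_subset VB sh.
  exact: bilin_field_subset VV0 sW0.1.
exists V, W; split=> //.
- by split=> //; exact: ballxx.
- by split=> // i u /(cod_subset VV0) cu; apply: ellZ; exact: sW0.2.
(* Closedness is required in every chart, while [f] and its derivatives are known in the chart
   [i0]. *)
- apply: (closed_form_chart Vo Vi0 WB) => [i u /(cod_subset VV0) cu|u cu a b c].
    by rewrite linearZ /= (W0p _ _ cu).2 scalerN.
  have Vco : open (cod V i0) by exact: cod_open.
  have Bu := VB u cu; have Uu := rU u Bu.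
  have WE b' c' y : cod V i0 y -> W i0 y b' c' = h y * W0 i0 y b' c'.
    by move=> /codP[_ _ yE]; rewrite /W mxE yE.
  have df : differentiable (fun y => - f y) u.
    exact: (Ck_diff Bo Bu (smoothN Bo sf 1%N)).1.
  have dh : derivable_at h u by exact: smooth_derivable_at sh Bu.
  have ph a' : pd a' h u = - theta a' u * h u.
    by rewrite /h pd_expR // pdN ?fE //; exact: smooth_derivable_at sf Bu.
  have pW a' b' c' : pd a' (fun y => W i0 y b' c') u
      = h u * (pd a' (fun y => W0 i0 y b' c') u - theta a' u * W0 i0 u b' c').
    rewrite (pd_eq a' Vco cu (WE b' c')) (pdM a' dh (smooth_derivable_at (sW0U b' c') Uu)) ph.
    ring.
  rewrite !pW -!mulrDr; apply/eqP; rewrite mulf_eq0; apply/orP; right; apply/eqP.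
  have := E u Uu a b c; set X := _ + _ => XE.
  transitivity (X - (theta a u * W0 i0 u b c + theta b u * W0 i0 u c a
      + theta c u * W0 i0 u a b)).
    rewrite /X; ring.
  by rewrite XE subrr.
- move=> i di; rewrite /W mchartK // scaler_eq0 negb_or gt_eqF ?expR_gt0 //=.
  by apply: (unit_neq0 m0); have [] := W0p i _ (cod_chart di V0x).
Qed.

End TorsionFreePcs.

(** * Local Kaehler metrics: parallelism, existence, uniqueness *)

Section Kahler.
Variables (R : realType) (p q : nat) (M : manifold R (p + q).*2) (S : pacs M).
Variable nabla : field12 M.
Local Notation m := ((p + q).*2).
Local Notation J := (cstr S).
Implicit Types (V : set M) (i j : mindex M) (x : M) (u : 'rV[R]_m) (W G : 'M[R]_m).
Hypothesis pq2 : (2 <= p + q)%N.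
Hypothesis nablaC : canonical_connection S nabla.

Let m_gt2 : (2 < m)%N.
Proof. by have := pq2; rewrite -leq_double; apply: leq_trans. Qed.

Let m_gt0 : (0 < m)%N. Proof. exact: leq_trans m_gt2. Qed.

Lemma conf_ratio i u G G' : cod setT i u -> conf S i u G -> conf S i u G' ->
  exists2 k, k != 0 & G' = k *: G.
Proof.
move=> cu; have [du _ E] := codP cu.
have [V [g [Vo Vx gH gC]]] := conf_local S (mpar i u).
have cVu : cod V i u by rewrite -E; exact: cod_chart.
rewrite (gC i u cVu) => -[k k0 ->] [k' k'0 ->].
by exists (k' / k); rewrite ?mulf_neq0 ?invr_eq0 // scalerA divfK.
Qed.

Lemma confZ i u G k : cod setT i u -> conf S i u G -> k != 0 -> conf S i u (k *: G).
Proof.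
move=> cu; have [du _ E] := codP cu.
have [V [g [Vo Vx gH gC]]] := conf_local S (mpar i u).
have cVu : cod V i u by rewrite -E; exact: cod_chart.
rewrite (gC i u cVu) => -[k' k'0 ->] k0.
by exists (k * k'); rewrite ?mulf_neq0 // scalerA.
Qed.

Lemma fundamental_mulJt (j W : 'M[R]_m) : j *m j = - 1%:M -> fundamental j (W *m j^T) = W.
Proof.
move=> jj; have jt : (- 1%:M)^T = - 1%:M :> 'M[R]_m by rewrite linearN /= trmx1.
by rewrite /fundamental -mulmxA -trmx_mul jj jt mulmxN mulmx1 opprK.
Qed.

Lemma integrable_subset V V' : V `<=` V' -> integrable_acs V' J -> integrable_acs V J.
Proof. by move=> VV' H i U Uo UV; apply: H => // u /UV; exact: cod_subset. Qed.

Lemma kahler_parallel V g i u : open V -> kahler_in_class S V g -> cod V i u ->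
  (forall a, torsion nabla i u a = 0) /\
  forall a, cov_bilin nabla (fun i u => fundamental (J i u) (g i u)) i u a = 0.
Proof.
move=> Vo [gC [cl iJ]] cu; apply: (torsion_vanish pq2 nablaC Vo _ cu).
- exact: fundamental_section.
- by apply: unit_neq0 => //; have [] := hermitian_fundamental gC.1 cu.
- exact: cl.
- exact: (integrable_proj02 nablaC Vo iJ cu).
Qed.

Lemma kahler_levi_civita V g : open V -> kahler_in_class S V g -> levi_civita V g nabla.
Proof.
move=> Vo gK; have [gC _] := gK; have [[sG tG] [cJ _] _] := nablaC; split.
- split; first by move=> i a b c; apply: smooth_subset (sG i a b c); exact: cod_subT.
  by move=> i j x _; exact: tG.
- by move=> i u cu; have [] := kahler_parallel Vo gK cu.
move=> i u cu a; have cuT := cod_subT cu.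
have Uo : open (cod V i) by exact: cod_open.
have [_ cW] := kahler_parallel Vo gK cu.
have [[sW _] _] := fundamental_section Vo gC.
have := cov_bilin_mulJt (cstr_derivable cuT) (smooth_derivable_mx (sW i) cu)
  (cJ i u cuT a) (cW a).
rewrite /cov_bilin /= fundamentalK; last exact: (cstr_sq S cuT).
rewrite (@dmx_eq _ _ _ _ (g i) u a Uo cu) // => y cy.
by rewrite fundamentalK //; exact: (cstr_sq S (cod_subT cy)).
Qed.

(** Integrability is given only on small sets, whereas the conclusion concerns every open set in a
    chart. The two are linked by a pointwise condition, the vanishing of the (0,2)-part of the
    torsion. *)
Lemma locally_kahler_pcs : locally_kahler S -> pcs S /\ integrable_acs setT J.
Proof.
move=> H; split=> [x|].
  have [V [g [Vo Vx [gC [cl _]]]]] := H x.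
  exists V, (fun i u => fundamental (J i u) (g i u)); split=> //.
    exact: fundamental_section.
  move=> i di; apply: (unit_neq0 m_gt0).
  by have [] := hermitian_fundamental gC.1 (cod_chart di Vx).
apply: (proj02_integrable nablaC) => i u cu; have [du _ E] := codP cu.
have [V [g [Vo Vx [gC [_ iJ]]]]] := H (mpar i u).
by apply: (integrable_proj02 nablaC Vo iJ); rewrite -E; exact: cod_chart.
Qed.

Lemma signatureZ r G k : 0 < k -> has_signature r G -> has_signature r (k *: G).
Proof.
move=> k0 [P Pu PE]; exists ((Num.sqrt k)^-1 *: P).
  by rewrite unitmxZ // unitfE invr_eq0 gt_eqF // sqrtr_gt0.
set c := (Num.sqrt k)^-1; have ck : c * c * k = 1.
  by rewrite /c -invfM -expr2 sqr_sqrtr ?ltW // mulVf // gt_eqF.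
have -> : (c *: P)^T = c *: P^T by rewrite linearZ.
rewrite -PE -[RHS]scale1r -ck -(scalemxAr c) -(scalemxAr k) -!scalemxAl !scalerA.
by rewrite mulrAC.
Qed.

(** A closed section of [ell] that is non-zero at [x] is a multiple of the fundamental form of a
    metric in the class. Near [x] the multiple has constant sign, and after correcting it the
    section itself is the fundamental form of a Kaehler metric. *)
Lemma pcs_locally_kahler : pcs S -> integrable_acs setT J -> locally_kahler S.
Proof.
move=> Hpcs iJ x; have [V [W [Vo Vx sW cW W0]]] := Hpcs x.
have [V0 [g0 [V0o V0x g0C ellP]]] := conf_localE S x.
pose V1 := V `&` V0; have V1o : open V1 by exact: openI.
pose O : mxfield M := fun i u => fundamental (J i u) (g0 i u).
have sO : section_ell S V0 O by exact: fundamental_section.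
have V1V : V1 `<=` V by move=> y [].
have V1V0 : V1 `<=` V0 by move=> y [].
have O0 i u : cod V0 i u -> O i u != 0.
  by move=> cu; apply: (unit_neq0 m_gt0); have [] := hermitian_fundamental g0C.1 cu.
have WB : bilin_field V1 W by exact: bilin_field_subset sW.1.
have OB : bilin_field V1 O by exact: bilin_field_subset sO.1.
have ratio i u : cod V1 i u -> exists c, W i u = c *: O i u.
  move=> cu; have cV := cod_subset V1V cu; have cV0 := cod_subset V1V0 cu.
  exact: ell_ratio (cod_subT cu) (sO.2 i u cV0) (O0 i u cV0) (sW.2 i u cV).
have [i0 dx] := mdom_cover x; pose u0 := mchart i0 x.
have cu0 : cod V1 i0 u0 by exact: cod_chart.
have [c0 c0E] := ratio i0 u0 cu0.
have [a [b Oab]] := mx_neq0 (O0 i0 u0 (cod_subset V1V0 cu0)).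
have c00 : c0 != 0.
  by apply: contraNneq (W0 i0 dx) => c00; rewrite -/u0 c0E c00 scale0r.
(* The sign is needed for signature (p, q) rather than (q, p). *)
pose s := Num.sg c0; have s0 : s != 0 by rewrite sgr_eq0.
pose A := [set y | V1 y /\ exists2 c, 0 < s * c &
  forall i, mdom i y -> W i (mchart i y) = c *: O i (mchart i y)].
have nA : nbhs x A.
  (* If [W = c *: O], then [h] is [s * c] times the square of an entry of [O]. Thus [h > 0], an open
     condition, forces [s * c > 0]. *)
  pose h u := s * (W i0 u a b * O i0 u a b).
  have Co : open (cod V1 i0) by exact: cod_open.
  have sh : smooth (cod V1 i0) h.
    apply: (smoothM Co (smooth_cst _ s)); apply: (smoothM Co); [exact: WB.1|exact: OB.1].
  have hE c u : W i0 u = c *: O i0 u -> h u = s * c * (O i0 u a b) ^+ 2.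
    by move=> E; rewrite /h E mxE expr2; ring.
  have h0 : 0 < h u0.
    rewrite (hE _ _ c0E) mulr_gt0 // ?exprn_even_gt0 //.
    by rewrite /s -normrEsg normr_gt0.
  have n1 : nbhs x V1 by exact: open_nbhs_nbhs.
  have n2 : nbhs x (mdom i0) by apply: open_nbhs_nbhs; split => //; exact: mdom_open.
  have n3 : nbhs x (fun y => 0 < h (mchart i0 y)).
    have n : nbhs u0 [set u | 0 < h u].
      have ch := smooth_continuous sh cu0.
      exact: (@cvgr_gt _ _ _ _ h (h u0) ch 0 h0).
    exact: (mchart_continuous dx n).
  apply: filterS (filterI n1 (filterI n2 n3)) => y [V1y [dy hy]].
  split=> //; have cy := cod_chart dy V1y; have [c cE] := ratio _ _ cy.
  exists c; last by move=> i di; exact: (bilin_ratio WB OB V1y dy di cE).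
  case: (ltP 0 (s * c)) => // sc0; move: hy.
  by rewrite (hE _ _ cE) ltNge mulr_le0_ge0 // sqr_ge0.
pose V2 := interior A; have V2o : open V2 by exact: open_interior.
have V2A : V2 `<=` A by exact: interior_subset.
have V21 : V2 `<=` V1 by move=> y /V2A[].
(* Multiplication by the transpose of [J] inverts [fundamental], so the fundamental form of [g] is
   [s *: W]. *)
pose g : mxfield M := fun i u => s *: (W i u *m (J i u)^T).
have gE i u : cod V2 i u -> exists2 c, 0 < c & g i u = c *: g0 i u.
  move=> cu; have [du V2u E] := codP cu; have [_ [c sc cE]] := V2A _ V2u.
  exists (s * c) => //; rewrite /g; have := cE i du; rewrite E => ->.
  by rewrite -scalemxAl scalerA fundamentalK //; exact: (cstr_sq S (cod_subT cu)).
exists V2, g; split=> //; split; first split.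
- split.
    apply: bilin_fieldZ => //; apply: bilin_field_mulJt => //.
      exact: endo_field_subset (@subsetT _ _) (cstr_endo S).
    exact: bilin_field_subset V21 WB.
  move=> i u cu; have [c c_gt0 ->] := gE i u cu.
  have [h1 h2 h3] := g0C.1.2 i u (cod_subset V1V0 (cod_subset V21 cu)).
  by split; [rewrite linearZ /= h1|rewrite -scalemxAr -scalemxAl h2|exact: signatureZ].
- move=> i u cu; have [c c_gt0 ->] := gE i u cu.
  apply: confZ (cod_subT cu) _ _; last by rewrite gt_eqF.
  exact: g0C.2 i u (cod_subset V1V0 (cod_subset V21 cu)).
split; last exact: integrable_subset (@subsetT _ _) iJ.
have V2V : V2 `<=` V by move=> y /V21/V1V.
move=> i u cu a' b' c'; have Uo : open (cod V2 i) by exact: cod_open.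
have FE y : cod V2 i y -> fundamental (J i y) (g i y) = s *: W i y.
  move=> cy; have JJ := cstr_sq S (cod_subT cy).
  by rewrite fundamentalZ fundamental_mulJt.
have cV := cod_subset V2V cu.
have pE t k l : pd t (fun y => fundamental (J i y) (g i y) k l) u
    = s * pd t (fun y => W i y k l) u.
  rewrite -pdZ; last exact: smooth_derivable_at (sW.1.1 i k l) cV.
  by apply: (pd_eq t Uo cu) => y cy; rewrite FE // mxE.
by rewrite !pE -!mulrDr (cW i u cV) mulr0.
Qed.

Lemma kahler_unique V g g' : open V -> connected V ->
  kahler_in_class S V g -> kahler_in_class S V g' ->
  exists2 k : R, k != 0 & forall i u, cod V i u -> g' i u = k *: g i u.
Proof.
have lin3 (x1 x2 x3 A B C F : R) :
    x1 + F * A + (x2 + F * B) + (x3 + F * C) = 0 -> A + B + C = 0 -> x1 + x2 + x3 = 0.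
  move=> h1 h2; have -> : x1 + x2 + x3
      = x1 + F * A + (x2 + F * B) + (x3 + F * C) - F * (A + B + C) by ring.
  by rewrite h1 h2 mulr0 subrr.
move=> Vo Vc [gC [cl _]] [g'C [cl' _]].
pose W : mxfield M := fun i u => fundamental (J i u) (g i u).
have [WB We] := fundamental_section Vo gC.
have W0p i u : cod V i u -> W i u \in unitmx /\ (W i u)^T = - W i u.
  by move=> cu; have [] := hermitian_fundamental gC.1 cu.
pose rat x := [set k : R | k != 0 /\
  forall i, mdom i x -> g' i (mchart i x) = k *: g i (mchart i x)].
have ratP x : V x -> rat x !=set0.
  move=> Vx; have [i0 dx] := mdom_cover x; have cx := cod_chart dx Vx.
  have [k k0 E] := conf_ratio (cod_subT cx) (gC.2 _ _ cx) (g'C.2 _ _ cx).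
  by exists k; split=> // i di; exact: (bilin_ratio g'C.1.1 gC.1.1 Vx dx di E).
(* The ratio as a function on the manifold, with default [0] where no ratio exists. Its regularity
   is seen in a chart, where it equals the quotient [F] of two smooth entries. *)
pose f x := xget 0 (rat x).
have fP x : V x -> rat x (f x) by move=> /ratP rk; exact: (xgetPex 0 rk).
have loc x : V x -> \forall y \near x, V y /\ f y = f x.
  move=> Vx; have [i dx] := mdom_cover x; pose u0 := mchart i x.
  have cu0 : cod V i u0 by exact: cod_chart.
  have [a [b Wab]] := mx_neq0 (unit_neq0 m_gt0 (W0p _ _ cu0).1).
  have Co : open (cod V i) by exact: cod_open.
  pose U := cod V i `&` [set u | W i u a b != 0].
  have Uo : open U by apply: open_neq0 => //; exact: WB.1.
  have UV : U `<=` cod V i by move=> u [].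
  pose W' : mxfield M := fun i u => fundamental (J i u) (g' i u).
  have W'B := (fundamental_section Vo g'C).1.
  pose F u := W' i u a b / W i u a b.
  have sF : smooth U F.
    apply: smoothM => //; first exact: smooth_subset UV (W'B.1 i a b).
    by apply: smoothV => // [u []//|]; exact: smooth_subset UV (WB.1 i a b).
  have W'E u : cod V i u -> W' i u = f (mpar i u) *: W i u.
    move=> cu; have [du Vu E] := codP cu; have [_ /(_ i du)] := fP _ Vu.
    by rewrite E /W' => ->; rewrite fundamentalZ.
  have FE u : U u -> F u = f (mpar i u).
    by move=> [cu u0']; rewrite /F W'E // mxE mulfK.
  have F0 u c : U u -> pd c F u = 0.
    move=> Uu; have cu := UV u Uu; have [Wu Ws] := W0p i u cu; move: c.
    apply: (theta_wedge0 m_gt2 Wu Ws) => c d e.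
    have pW' k k1 k2 : pd k (fun y => W' i y k1 k2) u
        = pd k F u * W i u k1 k2 + F u * pd k (fun y => W i y k1 k2) u.
      rewrite -pdM; last 2 first.
      - exact: smooth_derivable_at sF Uu.
      - exact: smooth_derivable_at (WB.1 i k1 k2) cu.
      by apply: (pd_eq k Uo Uu) => y Uy; rewrite W'E ?FE ?mxE //; exact: UV.
    have := cl' i u cu c d e; have := cl i u cu c d e.
    by move=> clW; rewrite !pW' => clW'; exact: lin3 clW' clW.
  have [r /= r0 rU] : exists2 r : R, 0 < r & ball u0 r `<=` U.
    by apply/nbhs_ballP; apply: open_nbhs_nbhs.
  have n1 : nbhs x V by exact: open_nbhs_nbhs.
  have n2 : nbhs x (mdom i) by apply: open_nbhs_nbhs; split => //; exact: mdom_open.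
  have n3 : nbhs x (fun y => ball u0 r (mchart i y)).
    by apply: (mchart_continuous dx); exact: nbhsx_ballx.
  apply: filterS (filterI n1 (filterI n2 n3)) => y [Vy [dy By]]; split=> //.
  have fF z : mdom i z -> U (mchart i z) -> f z = F (mchart i z).
    by move=> dz /FE ->; rewrite mchartK.
  have Ux : U (mchart i x) by apply: rU; exact: (ballxx u0 r0).
  rewrite (fF y dy (rU _ By)) (fF x dx Ux).
  apply: (@pd0_cst_ball _ _ F u0 r) => //; first exact: smooth_subset rU sF 1%N.
  by move=> z c Bz; apply: F0; exact: rU.
have [[x0 Vx0]|V0] := pselect (V !=set0); last first.
  (* For empty [V] any non-zero constant will do. *)
  exists 1; first exact: oner_neq0.
  by move=> i u [x [_ Vx]]; case: V0; exists x.
pose B := [set y | V y /\ f y = f x0].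
have Bo : open B.
  rewrite openE => y [Vy fy]; rewrite /interior /=.
  by apply: filterS (loc y Vy) => z [Vz fz]; split=> //; rewrite fz.
have Co : open [set y | V y /\ f y != f x0].
  rewrite openE => y [Vy fy]; rewrite /interior /=.
  by apply: filterS (loc y Vy) => z [Vz fz]; split=> //; rewrite fz.
(* The level set [B] of the locally constant ratio is open, and closed relative to [V] because its
   complement in [V] is open too. *)
have BV : B = V.
  apply: Vc; first by exists x0.
    by exists B => //; rewrite setIidr // => y [].
  exists (~` [set y | V y /\ f y != f x0]); first exact: open_closedC.
  apply/seteqP; split=> y /=.
    by move=> [Vy fy]; split=> // -[_]; rewrite fy eqxx.
  by move=> [Vy nf]; split=> //; apply/eqP/negP => /negP fy; apply: nf.
exists (f x0); first by have [] := fP _ Vx0.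
move=> i u cu; have [du Vu E] := codP cu; have [_ /(_ i du)] := fP _ Vu.
rewrite E => ->; congr (_ *: _).
have : B (mpar i u) by rewrite BV.
by case.
Qed.

End Kahler.

Unset Implicit Arguments.

Theorem proposition4p5 (R : realType) :
  exists c : R, c != 0 /\
  forall (p q : nat) (M : manifold R (p + q).*2) (S : pacs M)
         (nabla : field12 M),
  (2 <= p + q)%N -> canonical_connection S nabla ->
  [/\ (* the harmonic torsion is c times the Nijenhuis tensor *)
      forall Th : field12 M,
        harmonic_torsion S nabla Th <->
        (forall i u, cod setT i u -> forall a,
           Th i u a = c *: nijenhuis_tensor (cstr S) i u a),
      (* torsion freeness; dimension four needs the PCS condition *)
      (3 <= p + q)%N ->
        (torsion_free setT nabla <-> pcs S /\ integrable_acs setT (cstr S)),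
      pcs S -> (torsion_free setT nabla <-> integrable_acs setT (cstr S)),
      (* local (pseudo-)Kaehler metrics *)
      pcs S /\ integrable_acs setT (cstr S) <-> locally_kahler S
    & (* uniqueness of local Kaehler metrics, and Levi-Civita connections *)
      (forall (V : set M) (g g' : mxfield M), open V -> connected V ->
         kahler_in_class S V g -> kahler_in_class S V g' ->
         exists2 k : R, k != 0 &
           forall i u, cod V i u -> g' i u = k *: g i u) /\
      (forall (V : set M) (g : mxfield M), open V ->
         kahler_in_class S V g -> levi_civita V g nabla)].
Proof.
exists (- 4^-1); split; first by rewrite oppr_eq0 invr_eq0 pnatr_eq0.
move=> p q M S nabla pq2 nablaC.
have TI : torsion_free setT nabla -> integrable_acs setT (cstr S).
  move=> T0; apply: (proj02_integrable nablaC) => i u cu v w.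
  have -> : torsion nabla i u = (fun=> 0) by apply/funext => a; exact: T0.
  have z v' w' : eval12 (fun _ => 0 : 'M[R]_((p + q).*2)) v' w' = 0.
    by rewrite /eval12 big1 // => a _; rewrite mulmx0 scaler0.
  by rewrite /proj02 !z !mul0mx subrr !addr0.
(* Vanishing of the torsion is pointwise, so one local Kaehler metric around each point is
   enough. *)
have IT : pcs S -> integrable_acs setT (cstr S) -> torsion_free setT nabla.
  move=> P I i u cu; have K := pcs_locally_kahler pq2 P I.
  have [du _ E] := codP cu; have [V [g [Vo Vx gK]]] := K (mpar i u).
  have cV : cod V i u by rewrite -E; exact: cod_chart.
  by have [] := kahler_parallel pq2 nablaC Vo gK cV.
split.
- exact: harmonic_torsionP.
- move=> pq3; split=> [T0|[]]; last exact: IT.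
  by split; [exact: torsion_free_pcs nablaC pq3 T0|exact: TI].
- by move=> P; split; [exact: TI|exact: IT].
- split=> [[]|]; first exact: pcs_locally_kahler.
  exact: locally_kahler_pcs pq2 nablaC.
- split=> [V g g'|V g]; first exact: kahler_unique.
  exact: kahler_levi_civita.
Qed.
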